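(* There exist two non-isomorphic AF-algebras $A$ and $B$, a directed family $\mathcal{A}$ of finite dimensional $C^*$-subalgebras of $A$ with dense union in $A$, and a directed family $\mathcal{B}$ of finite dimensional $C^*$-subalgebras of $B$ with dense union in $B$, such that $\mathcal{A}$ and $\mathcal{B}$ define isomorphic Bratteli diagrams.
   Context: A directed family of $C^*$-subalgebras is a set of $C^*$-subalgebras that is directed under inclusion (any two members are contained in a third). A $C^*$-algebra (not necessarily separable) is called an AF-algebra if it has a directed family of finite dimensional $C^*$-subalgebras whose union is dense. Every finite dimensional $C^*$-algebra is isomorphic to $\bigoplus_{i=1}^{k} M_{n_i}(\mathbb{C})$ for some $k$ and positive integers $n_1,\dots,n_k$ (with $k=0$ for the zero algebra). A $*$-homomorphism $\varphi\colon \bigoplus_{i=1}^{k} M_{n_i}(\mathbb{C})\to\bigoplus_{j=1}^{k'} M_{n'_j}(\mathbb{C})$ (not necessarily unital) has a $k'\times k$ multiplicity matrix, whose $(j,i)$-entry is the multiplicity of the $*$-homomorphism $M_{n_i}(\mathbb{C})\to M_{n'_j}(\mathbb{C})$ obtained by restricting $\varphi$ to the $i$-th summand and projecting to the $j$-th summand. Given a family $(A_\lambda)_{\lambda\in\Lambda}$ of finite dimensional $C^*$-subalgebras indexed by a directed set $\Lambda$ with $A_\lambda\subset A_\mu$ for $\lambda\preceq\mu$ (for a set of $C^*$-subalgebras that is directed under inclusion, the index set is that set itself ordered by inclusion), its Bratteli diagram is the system $(n_\lambda,N_{\mu,\lambda})$, where $n_\lambda=((n_\lambda)_1,\dots,(n_\lambda)_{k_\lambda})$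 is such that $A_\lambda\cong\bigoplus_{i=1}^{k_\lambda}M_{(n_\lambda)_i}(\mathbb{C})$ and, for $\lambda\prec\mu$, $N_{\mu,\lambda}$ is the $k_\mu\times k_\lambda$ multiplicity matrix of the inclusion $A_\lambda\subset A_\mu$. Two Bratteli diagrams are isomorphic if there are an order isomorphism between their index sets and, for each index, a bijection between the sets of simple summands at corresponding indices, which preserve all the sizes $(n_\lambda)_i$ and all the multiplicities $(N_{\mu,\lambda})_{j,i}$. *)

(* Defs.v *)
From HB Require Import structures.
From mathcomp Require Import all_boot all_order all_algebra.
From mathcomp Require Import complex.
From mathcomp Require Import all_classical all_reals all_analysis.

Set Implicit Arguments.
Unset Strict Implicit.
Unset Printing Implicit Defensive.

Import Order.TTheory GRing.Theory Num.Theory.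
Import numFieldNormedType.Exports.

Local Open Scope classical_set_scope.
Local Open Scope ring_scope.
Local Open Scope sesquilinear_scope.

(* The multiplication is not taken from the ring hierarchy because rings
   there have a unit, while C*-algebras need not. The norm has values in
   R[i]; it is a nonnegative, hence real, number. *)
HB.mixin Record CompleteNormedModule_isCStarAlgebra (R : realType) A
    of CompleteNormedModule R[i] A := {
  cmul : A -> A -> A;
  cstar : A -> A;
  cmulA : forall x y z, cmul x (cmul y z) = cmul (cmul x y) z;
  cmulDl : forall x y z, cmul (x + y) z = cmul x z + cmul y z;
  cmulDr : forall x y z, cmul x (y + z) = cmul x y + cmul x z;
  cmulZl : forall (c : R[i]) x y, cmul (c *: x) y = c *: cmul x y;
  cmulZr : forall (c : R[i]) x y, cmul x (c *: y) = c *: cmul x y;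
  cstarK : forall x, cstar (cstar x) = x;
  cstarD : forall x y, cstar (x + y) = cstar x + cstar y;
  cstarZ : forall (c : R[i]) x, cstar (c *: x) = Num.conj c *: cstar x;
  cstarM : forall x y, cstar (cmul x y) = cmul (cstar y) (cstar x);
  norm_cmul : forall x y, `|cmul x y| <= `|x| * `|y|;
  norm_cstar_cmul : forall x, `|cmul (cstar x) x| = `|x| ^+ 2
}.

#[short(type="cstarAlgType")]
HB.structure Definition CStarAlgebra (R : realType) :=
  {A of CompleteNormedModule_isCStarAlgebra R A & CompleteNormedModule R[i] A}.

Section Subalgebras.
Context {R : realType}.

Definition star_hom (A B : cstarAlgType R) (f : A -> B) : Prop :=
  [/\ forall (c : R[i]) x y, f (c *: x + y) = c *: f x + f y,
      forall x y, f (cmul x y) = cmul (f x) (f y)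
    & forall x, f (cstar x) = cstar (f x)].

Definition cstar_isomorphic (A B : cstarAlgType R) : Prop :=
  exists2 f : A -> B, star_hom f & bijective f.

Definition cstar_subalgebra (A : cstarAlgType R) (S : set A) : Prop :=
  [/\ S 0,
      forall (c : R[i]) x y, S x -> S y -> S (c *: x + y),
      forall x y, S x -> S y -> S (cmul x y),
      forall x, S x -> S (cstar x)
    & closed S].

Definition finite_dimensional (A : cstarAlgType R) (S : set A) : Prop :=
  exists (d : nat) (e : 'I_d -> A),
    S = [set x | exists c : 'I_d -> R[i], x = \sum_i c i *: e i].

(* A directed family of finite dimensional C*-subalgebras with dense union;
   density in A rules out the empty family. *)
Definition af_family (A : cstarAlgType R) (F : set (set A)) : Prop :=
  [/\ forall S, F S -> cstar_subalgebra S /\ finite_dimensional S,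
      forall S T, F S -> F T -> exists U, [/\ F U, S `<=` U & T `<=` U]
    & dense (\bigcup_(S in F) S)].

Definition af_algebra (A : cstarAlgType R) : Prop :=
  exists F : set (set A), af_family F.

End Subalgebras.

Section Multimatrix.
Variable R : realType.

(* The direct sum of the matrix algebras of sizes n i, with the pointwise
   operations; t* is the conjugate transpose. *)
Definition multimx (k : nat) (n : 'I_k -> nat) : Type :=
  forall i, 'M[R[i]]_(n i).

(* psi is a *-isomorphism from the direct sum onto S. *)
Definition multimx_iso (A : cstarAlgType R) (S : set A)
    (k : nat) (n : 'I_k -> nat) (psi : multimx n -> A) : Prop :=
  [/\ forall (c : R[i]) (x y : multimx n),
        psi (fun i => c *: x i + y i) = c *: psi x + psi y,
      forall x y : multimx n,
        psi (fun i => x i *m y i) = cmul (psi x) (psi y),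
      forall x : multimx n, psi (fun i => (x i)^t*) = cstar (psi x),
      injective psi
    & range psi = S].

(* phi is unitarily equivalent to a |-> diag(a, ..., a, 0), with l copies
   of a and a zero block of size r. *)
Definition has_multiplicity (n m : nat)
    (phi : 'M[R[i]]_n -> 'M[R[i]]_m) (l : nat) : Prop :=
  exists (r : nat) (e : (\sum_(i < l) n + r)%N = m) (U : 'M[R[i]]_m),
    U \is unitarymx /\
    forall a, phi a =
      U *m castmx (e, e) (block_mx (\mxdiag_(i < l) a) 0 0 0) *m U^t*.

(* [dfwith (fun=> 0) i a] is a in the i-th summand and 0 in the others. *)
Definition has_multiplicity_matrix (k k' : nat)
    (n : 'I_k -> nat) (n' : 'I_k' -> nat)
    (phi : multimx n -> multimx n') (N : 'M[nat]_(k', k)) : Prop :=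
  forall (j : 'I_k') (i : 'I_k),
    has_multiplicity
      (fun a : 'M[R[i]]_(n i) =>
         phi (dfwith (T := fun i => 'M[R[i]]_(n i)) (fun=> 0) i a) j) (N j i).

End Multimatrix.

(* [bd_mult D m l] is meaningful only when l strictly precedes m. *)
Record bratteli_diagram (I : Type) := BratteliDiagram {
  bd_num : I -> nat;
  bd_size : forall l, 'I_(bd_num l) -> nat;
  bd_size_gt0 : forall l i, (0 < @bd_size l i)%N;
  bd_mult : forall m l, 'M[nat]_(bd_num m, bd_num l)
}.

Definition prec (I : Type) (le : I -> I -> Prop) (l m : I) : Prop :=
  le l m /\ l <> m.

(* D is obtained from the family S by choosing an identification psi l of
   each S l with a direct sum of matrix algebras; the map phi below is the
   inclusion of S l in S m read through psi l and psi m. *)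
Definition is_bratteli_diagram (R : realType) (A : cstarAlgType R)
    (I : Type) (le : I -> I -> Prop) (S : I -> set A)
    (D : bratteli_diagram I) : Prop :=
  exists psi : forall l, multimx R (@bd_size I D l) -> A,
    (forall l, multimx_iso (S l) (psi l)) /\
    forall l m, prec le l m ->
      exists phi : multimx R (@bd_size I D l) -> multimx R (@bd_size I D m),
        (forall x, psi m (phi x) = psi l x) /\
        has_multiplicity_matrix phi (bd_mult D m l).

Definition bratteli_isomorphic (I J : Type)
    (leI : I -> I -> Prop) (leJ : J -> J -> Prop)
    (D : bratteli_diagram I) (E : bratteli_diagram J) : Prop :=
  exists (f : I -> J) (s : forall l, 'I_(bd_num D l) -> 'I_(bd_num E (f l))),
    [/\ bijective f,
        forall l m, leI l m <-> leJ (f l) (f m),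
        forall l, bijective (s l),
        forall l i, bd_size (s l i) = bd_size i
      & forall l m, prec leI l m -> forall j i,
          bd_mult E (f m) (f l) (s m j) (s l i) = bd_mult D m l j i].

(* A set of subalgebras, as a family indexed by itself. *)
Definition family_le (R : realType) (A : cstarAlgType R) (F : set (set A))
    (S T : F) : Prop := val S `<=` val T.

Definition family_diagram (R : realType) (A : cstarAlgType R)
    (F : set (set A)) (D : bratteli_diagram F) : Prop :=
  is_bratteli_diagram (@family_le R A F) (fun S : F => val S) D.

(* Main.v *)
From HB Require Import structures.
Require Import Defs.
From mathcomp Require Import all_boot all_order all_algebra.
From mathcomp Require Import complex.
From mathcomp Require Import all_classical all_reals all_analysis.
From mathcomp Require Import finmap ring lra.

(* Fix an uncountable set X and a unitary 2 x 2 matrix V. Consider the bounded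
   families a made of a scalar a_x for every point x and a 2 x 2 matrix a_xy for
   every pair (x, y), such that the a_x tend to 0 and
   a_xy - a_x e11 - a_y V e11 V^* tends to 0 when (x, y) leaves the finite
   squares E x E. They form a C*-algebra, an extension of c_0(X) by
   c_0(X x X, M_2). For a finite set E, the
   families for which a_x and that difference are 0 outside E and E x E form a
   finite dimensional subalgebra. In a larger subalgebra a_x contributes one copy
   of itself to the block at (x, y), and one to the block at (y, x), when y is not
   in E. These multiplicities do not depend on V.

   For V = 1 the quotient c_0(X) lifts to commuting elements. Suppose that this
   algebra is isomorphic to the one of a V for which e11 and V e11 V^* do not
   commute. Every element of the ideal is a multiple of a commutator, so the
   isomorphism maps the ideal into the ideal and gives commuting elements r_x
   such that p_x - r_x is in the ideal, where p_x is the projection attached to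
   the point x. Up to a fixed error p_x and r_x agree at all pairs outside a
   finite square E_x x E_x. As X is uncountable there are two points x, y with
   y not in E_x and x not in E_y, and then p_x and p_y almost commute at the
   pair (x, y), where they are e11 and V e11 V^*: a contradiction. *)

Set Implicit Arguments.
Unset Strict Implicit.
Unset Printing Implicit Defensive.

Import Order.TTheory GRing.Theory Num.Theory.
Import numFieldNormedType.Exports.

Local Open Scope classical_set_scope.
Local Open Scope ring_scope.
Local Open Scope sesquilinear_scope.

(** * Operator norms *)

Lemma sqr_le_sqrtC (C : numClosedFieldType) (x y : C) : 0 <= x -> 0 <= y ->
  (x ^+ 2 <= y) = (x <= sqrtC y).
Proof. by move=> x0 y0; rewrite -[y in LHS]sqrtCK ler_sqr ?nnegrE ?sqrtC_ge0. Qed.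

Lemma sqrtC_le (C : numClosedFieldType) (x e : C) : 0 <= x -> 0 <= e ->
  x <= e ^+ 2 -> sqrtC x <= e.
Proof. by move=> x0 e0 xe; rewrite -(sqrCK e0) ler_sqrtC ?nnegrE ?exprn_ge0. Qed.

Section RowNorm.
Variables (C : numClosedFieldType) (d : nat).
Implicit Types (u v : 'rV[C]_d) (m : 'M[C]_d).

Definition row_norm v : C := sqrtC (dotmx v v).

Lemma row_norm_ge0 v : 0 <= row_norm v.
Proof. exact: sqrt_dnorm_ge0. Qed.

Lemma row_norm_eq0 v : (row_norm v == 0) = (v == 0).
Proof. exact: sqrt_dnorm_eq0. Qed.

Lemma row_norm0 : row_norm 0 = 0.
Proof. by apply/eqP; rewrite row_norm_eq0. Qed.

Lemma row_normD u v : row_norm (u + v) <= row_norm u + row_norm v.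
Proof. exact: triangle_lerif. Qed.

Lemma row_normZ (c : C) v : row_norm (c *: v) = `|c| * row_norm v.
Proof.
rewrite /row_norm dnormZ rootCMl ?exprn_ge0// sqrCK//.
Qed.

Lemma sqr_row_norm v : row_norm v ^+ 2 = dotmx v v.
Proof. exact: sqrtCK. Qed.

Lemma dotmx_le u v : `|dotmx u v| <= row_norm u * row_norm v.
Proof. exact: CauchySchwarz_sqrt. Qed.

Lemma dotmx_adj u v m : dotmx (u *m m) v = dotmx u (v *m m^t*).
Proof. by rewrite !dotmxE trmx_mul map_mxM trmxCK mulmxA. Qed.

Lemma row_norm_delta p : row_norm (delta_mx 0 p) = 1.
Proof.
rewrite /row_norm dotmxE mxE (bigD1 p)//= !mxE !eqxx/= conjC1 mulr1.
rewrite big1 ?addr0 ?sqrtC1// => q /negbTE qp; by rewrite !mxE qp mul0r.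
Qed.

Lemma entry_le_row_norm v p : `|v 0 p| <= row_norm v.
Proof.
have -> : v 0 p = dotmx v (delta_mx 0 p).
  rewrite dotmxE mxE (bigD1 p)//= !mxE !eqxx/= conjC1 mulr1.
  by rewrite big1 ?addr0// => q /negbTE qp; rewrite !mxE qp conjC0 mulr0.
by apply: le_trans (dotmx_le _ _) _; rewrite row_norm_delta mulr1.
Qed.

Definition op_bounded (c : C) m := forall v, row_norm (v *m m) <= c * row_norm v.

Lemma op_bounded_entry c m p q : op_bounded c m -> `|m p q| <= c.
Proof.
move=> /(_ (delta_mx 0 p)); rewrite row_norm_delta mulr1; apply: le_trans.
by have := entry_le_row_norm (delta_mx 0 p *m m) q; rewrite -rowE mxE.
Qed.

(** Expanding [v *m m] along rows and columns gives [d * d] terms, each of norm at most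
    [c * row_norm v]. Together with [op_bounded_entry] this makes entrywise and operator bounds
    equivalent, so limits can be handled entry by entry. *)
Lemma entry_op_bounded c m : 0 <= c -> (forall p q, `|m p q| <= c) ->
  op_bounded (c * (d * d)%:R) m.
Proof.
move=> c0 mc v.
have norm_sum n (f : 'I_n -> 'rV[C]_d) :
    row_norm (\sum_i f i) <= \sum_i row_norm (f i).
  apply: (big_ind2 (fun x y => row_norm x <= y)) => [|x1 x2 y1 y2 h1 h2|//].
    by rewrite row_norm0.
  by apply: le_trans (row_normD _ _) _; exact: lerD.
have -> : v *m m = \sum_p \sum_q (v 0 p * m p q) *: delta_mx 0 q.
  apply/rowP => q; rewrite mxE summxE; apply: eq_bigr => p _.
  rewrite summxE (bigD1 q)//= !mxE !eqxx mulr1 big1 ?addr0// => r rq.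
  by rewrite !mxE eqxx/= eq_sym (negbTE rq) mulr0.
apply: le_trans (norm_sum _ _) _.
have -> : c * (d * d)%:R * row_norm v = \sum_(p < d) \sum_(q < d) c * row_norm v.
  by rewrite !sumr_const !card_ord -mulrnA -[RHS]mulr_natr mulrAC.
apply: ler_sum => p _; apply: le_trans (norm_sum _ _) _.
apply: ler_sum => q _; rewrite row_normZ row_norm_delta mulr1 normrM mulrC.
by apply: ler_pM => //; exact: entry_le_row_norm.
Qed.

Lemma op_boundedD c1 c2 m1 m2 : op_bounded c1 m1 -> op_bounded c2 m2 ->
  op_bounded (c1 + c2) (m1 + m2).
Proof.
move=> b1 b2 v; rewrite mulmxDr mulrDl; apply: le_trans (row_normD _ _) _.
exact: lerD.
Qed.

Lemma op_boundedZ a c m : op_bounded c m -> op_bounded (`|a| * c) (a *: m).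
Proof. by move=> b v; rewrite -scalemxAr row_normZ -mulrA ler_wpM2l. Qed.

Lemma op_boundedM c1 c2 m1 m2 : 0 <= c2 -> op_bounded c1 m1 ->
  op_bounded c2 m2 -> op_bounded (c1 * c2) (m1 *m m2).
Proof.
move=> c0 b1 b2 v; rewrite mulmxA; apply: le_trans (b2 _) _.
by rewrite mulrAC mulrC ler_wpM2r.
Qed.

(* [|v m|^2 = <v m m^*, v> <= |v m m^*| |v|], the source of both the isometry
   of the involution and the C*-identity. *)
Lemma op_bounded_sqrtC c m : 0 <= c -> op_bounded c (m *m m^t*) ->
  op_bounded (sqrtC c) m.
Proof.
move=> c0 b v; rewrite -ler_sqr ?nnegrE ?mulr_ge0 ?row_norm_ge0 ?sqrtC_ge0//.
rewrite sqr_row_norm dotmx_adj exprMn sqrtCK (expr2 (row_norm v)) mulrA.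
rewrite -[leLHS]ger0_norm ?[dotmx _ _]dnorm_ge0//; last first.
  by rewrite -dotmx_adj dnorm_ge0.
apply: le_trans (dotmx_le _ _) _.
by rewrite mulrC ler_wpM2r ?row_norm_ge0// -mulmxA.
Qed.

End RowNorm.

(** Matrices act on row vectors from the right. The vector 0 contributes the quotient 0, since
    dividing by 0 gives 0. The quotients are already real; [complex.Re] moves them to [R], where
    suprema are taken. *)
Definition op_quotients (R : realType) (I : Type) (d : nat)
    (a : I -> 'M[R[i]]_d) : set R :=
  [set r | exists i v, r = complex.Re (row_norm (v *m a i) / row_norm v)].

(* Locked, since unification would otherwise unfold suprema of complex
   quotients when comparing norms of different elements. *)
HB.lock Definition op_norm (R : realType) (I : Type) (d : nat)
    (a : I -> 'M[R[i]]_d) : R[i] := (sup (op_quotients a))%:C%C.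

Section OpNorm.
Variables (R : realType) (I : Type) (d : nat).
Implicit Types a b : I -> 'M[R[i]]_d.

Definition entry_bounded a := exists c : R[i], forall i p q, `|a i p q| <= c.

Lemma op_quotients_le a (c : R[i]) i v : 0 <= c -> op_bounded c (a i) ->
  complex.Re (row_norm (v *m a i) / row_norm v) <= complex.Re c.
Proof.
move=> c0 ac; rewrite -lecR !RRe_real ?ger0_real ?divr_ge0 ?row_norm_ge0//.
have [->|v0] := eqVneq v 0; first by rewrite row_norm0 invr0 mulr0.
rewrite ler_pdivrMr ?lt_def ?row_norm_eq0 ?v0 ?row_norm_ge0//.
Qed.

Lemma entry_op_boundedP a : entry_bounded a ->
  exists2 c : R[i], 0 <= c & forall i, op_bounded c (a i).
Proof.
move=> [c ac]; exists (`|c| * (d * d)%:R); first by rewrite mulr_ge0.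
move=> i; apply: entry_op_bounded => // p q; apply: le_trans (ac i p q) _.
by apply: real_ler_norm; rewrite ger0_real// (le_trans _ (ac i p q)).
Qed.

Lemma op_norm_bounded a i : entry_bounded a -> op_bounded (op_norm a) (a i).
Proof.
rewrite op_norm.unlock => /entry_op_boundedP[c c0 ac] v.
have [->|v0] := eqVneq v 0; first by rewrite mul0mx row_norm0 mulr0.
rewrite -ler_pdivrMr ?lt_def ?row_norm_eq0 ?v0 ?row_norm_ge0//.
rewrite -[leLHS]RRe_real ?ger0_real ?divr_ge0 ?row_norm_ge0// lecR.
apply: ub_le_sup; last by exists i, v.
by exists (complex.Re c) => _ [j [w ->]]; exact: op_quotients_le.
Qed.

Lemma op_norm_le a c : 0 <= c -> (forall i, op_bounded c (a i)) -> op_norm a <= c.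
Proof.
rewrite op_norm.unlock => c0 ac; rewrite -(RRe_real (ger0_real c0)) lecR.
(* There are no quotients when [I] is empty; the supremum is then 0. *)
have [->|/set0P[r ar]] := eqVneq (op_quotients a) set0.
  by rewrite sup0 -lecR RRe_real ?ger0_real.
apply: ge_sup; first by exists r.
by move=> _ [j [w ->]]; exact: op_quotients_le.
Qed.

Lemma op_norm_ge0 a : 0 <= op_norm a.
Proof.
rewrite op_norm.unlock ler0c.
have [[[r ar] ab]|/sup_out->//] := pselect (has_sup (op_quotients a)).
apply: le_trans (ub_le_sup ab ar); have [i [v ->]] := ar.
by rewrite -ler0c RRe_real ?ger0_real ?divr_ge0 ?row_norm_ge0.
Qed.

Lemma entry_le_op_norm a i p q : entry_bounded a -> `|a i p q| <= op_norm a.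
Proof. by move=> ab; apply: op_bounded_entry; exact: op_norm_bounded. Qed.

Lemma op_norm_entry_le a c : 0 <= c -> (forall i p q, `|a i p q| <= c) ->
  op_norm a <= c * (d * d)%:R.
Proof.
by move=> c0 ac; apply: op_norm_le => [|i]; [rewrite mulr_ge0|exact: entry_op_bounded].
Qed.

Lemma op_normD a b : entry_bounded a -> entry_bounded b ->
  op_norm (fun i => a i + b i) <= op_norm a + op_norm b.
Proof.
move=> ab bb; apply: op_norm_le => [|i]; first by rewrite addr_ge0 ?op_norm_ge0.
by apply: op_boundedD; exact: op_norm_bounded.
Qed.

Lemma op_normZ (c : R[i]) a : entry_bounded a ->
  op_norm (fun i => c *: a i) = `|c| * op_norm a.
Proof.
move=> ab; apply/le_anti/andP; split.
  apply: op_norm_le => [|i]; first by rewrite mulr_ge0 ?op_norm_ge0.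
  exact/op_boundedZ/op_norm_bounded.
have [->|c0] := eqVneq c 0; first by rewrite normr0 mul0r op_norm_ge0.
rewrite mulrC -ler_pdivlMr ?normr_gt0//; apply: op_norm_le => [|i].
  by rewrite divr_ge0 ?op_norm_ge0.
have -> : a i = c^-1 *: (c *: a i) by rewrite scalerA mulVf// scale1r.
rewrite mulrC -normfV; apply: op_boundedZ.
apply: (@op_norm_bounded (fun i => c *: a i)).
by have [k ak] := ab; exists (`|c| * k) => j p q; rewrite mxE normrM ler_wpM2l.
Qed.

Lemma op_norm_eq0 a : entry_bounded a -> op_norm a = 0 -> a = fun=> 0.
Proof.
move=> ab a0; apply/funext => i; apply/matrixP => p q; rewrite mxE.
by apply/eqP; rewrite -normr_le0 -a0 entry_le_op_norm.
Qed.

Lemma entry_bounded_star a : entry_bounded a -> entry_bounded (fun i => (a i)^t*).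
Proof. by move=> [c ac]; exists c => i p q; rewrite !mxE norm_conjC. Qed.

Lemma op_normM a b : entry_bounded a -> entry_bounded b ->
  op_norm (fun i => a i *m b i) <= op_norm a * op_norm b.
Proof.
move=> ab bb; apply: op_norm_le => [|i]; first by rewrite mulr_ge0 ?op_norm_ge0.
by apply: op_boundedM; rewrite ?op_norm_ge0//; exact: op_norm_bounded.
Qed.

Lemma entry_boundedM a b : entry_bounded a -> entry_bounded b ->
  entry_bounded (fun i => a i *m b i).
Proof.
move=> ab bb; exists (op_norm a * op_norm b) => i p q.
by apply: op_bounded_entry; apply: op_boundedM; rewrite ?op_norm_ge0//;
  exact: op_norm_bounded.
Qed.

Lemma sqr_op_norm_le a : entry_bounded a ->
  op_norm a ^+ 2 <= op_norm (fun i => a i *m (a i)^t*).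
Proof.
move=> ab.
have ab2 : entry_bounded (fun i => a i *m (a i)^t*).
  by apply: entry_boundedM => //; exact: entry_bounded_star.
have := @op_norm_bounded (fun i => a i *m (a i)^t*) _ ab2.
have := op_norm_ge0 (fun i => a i *m (a i)^t*).
move: (op_norm (fun i => a i *m (a i)^t*)) => s s0 sb.
rewrite sqr_le_sqrtC ?op_norm_ge0//; apply: op_norm_le => [|i].
  by rewrite sqrtC_ge0.
by apply: op_bounded_sqrtC => //; exact: sb.
Qed.

(** Cancel |b| in |b|^2 <= |b b^*| <= |b| |b^*|, then use the result for both [a] and its
    adjoint. *)
Lemma op_norm_star a : entry_bounded a -> op_norm (fun i => (a i)^t*) = op_norm a.
Proof.
suff le b : entry_bounded b -> op_norm b <= op_norm (fun i => (b i)^t*).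
  move=> ab; apply/le_anti/andP; split; last exact: (le a ab).
  have := le _ (entry_bounded_star ab); congr (_ <= op_norm _).
  by apply/funext => i; rewrite trmxCK.
move=> bb; have bs := entry_bounded_star bb.
have [->|b0] := eqVneq (op_norm b) 0; first exact: op_norm_ge0.
have {}b0 : 0 < op_norm b by rewrite lt_def b0 op_norm_ge0.
rewrite -(ler_pM2l b0) -expr2; apply: le_trans (sqr_op_norm_le bb) _.
exact: op_normM.
Qed.

Lemma op_norm_cstar a : entry_bounded a ->
  op_norm (fun i => (a i)^t* *m a i) = op_norm a ^+ 2.
Proof.
move=> ab; have as_ := entry_bounded_star ab; apply/le_anti/andP; split.
  by apply: le_trans (op_normM as_ ab) _; rewrite op_norm_star// expr2.
rewrite -op_norm_star//; apply: le_trans (sqr_op_norm_le as_) _.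
rewrite [X in op_norm X <= _](_ : _ = fun i => (a i)^t* *m a i)//.
by apply/funext => i; rewrite trmxCK.
Qed.

End OpNorm.

(** * C*-algebras of bounded matrix-valued functions *)

(** Star-algebras of bounded matrix-valued functions that are closed under uniform limits. Closure
    is stated entrywise, so that it can be checked without the operator norm. *)
Record uniform_star_algebra (R : realType) (I : Type) (d : nat) :=
    UniformStarAlgebra {
  usa_mem : set (I -> 'M[R[i]]_d);
  usa_bounded : forall a, usa_mem a -> entry_bounded a;
  usa0 : usa_mem (fun=> 0);
  usaP : forall (c : R[i]) a b, usa_mem a -> usa_mem b ->
    usa_mem (fun i => c *: a i + b i);
  usaM : forall a b, usa_mem a -> usa_mem b -> usa_mem (fun i => a i *m b i);
  usaS : forall a, usa_mem a -> usa_mem (fun i => (a i)^t*);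
  usa_closed : forall a : I -> 'M[R[i]]_d,
    (forall e : R[i], 0 < e ->
      exists2 b, usa_mem b & forall i p q, `|a i p q - b i p q| <= e) ->
    usa_mem a }.

Record usa_elt (R : realType) (I : Type) (d : nat)
    (P : uniform_star_algebra R I d) := UsaElt {
  usa_val :> I -> 'M[R[i]]_d;
  usa_valP : usa_mem P usa_val }.

HB.instance Definition _ (R : realType) (I : Type) (d : nat)
  (P : uniform_star_algebra R I d) := gen_eqMixin (usa_elt P).
HB.instance Definition _ (R : realType) (I : Type) (d : nat)
  (P : uniform_star_algebra R I d) := gen_choiceMixin (usa_elt P).

Section UsaAlgebra.
Variables (R : realType) (I : Type) (d : nat) (P : uniform_star_algebra R I d).
Local Notation T := (usa_elt P).
Implicit Types (x y z : T) (c : R[i]).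

Lemma usa_val_inj x y : (forall i, x i = y i) -> x = y.
Proof.
case: x y => [f Pf] [g Pg] /= fg; have {}fg : f = g by exact/funext.
by rewrite fg in Pf *; rewrite (Prop_irrelevance Pf Pg).
Qed.

Lemma usa_lin_mem c x y : usa_mem P (fun i => c *: x i + y i).
Proof. by apply: usaP; exact: usa_valP. Qed.

Definition usa_zero : T := UsaElt (usa0 P).

Lemma usa_add_mem x y : usa_mem P (fun i => x i + y i).
Proof.
by have := usa_lin_mem 1 x y; congr (usa_mem P _); apply/funext => i; rewrite scale1r.
Qed.
Definition usa_add x y : T := UsaElt (usa_add_mem x y).

Lemma usa_scale_mem c x : usa_mem P (fun i => c *: x i).
Proof.
have := usa_lin_mem c x usa_zero; congr (usa_mem P _).
by apply/funext => i; rewrite /= addr0.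
Qed.
Definition usa_scale c x : T := UsaElt (usa_scale_mem c x).
Definition usa_opp x : T := usa_scale (-1) x.

Definition usa_mul x y : T := UsaElt (usaM (usa_valP x) (usa_valP y)).
Definition usa_star x : T := UsaElt (usaS (usa_valP x)).

Fact usa_addA : associative usa_add.
Proof. by move=> x y z; apply: usa_val_inj => i /=; rewrite addrA. Qed.
Fact usa_addC : commutative usa_add.
Proof. by move=> x y; apply: usa_val_inj => i /=; rewrite addrC. Qed.
Fact usa_add0 : left_id usa_zero usa_add.
Proof. by move=> x; apply: usa_val_inj => i /=; rewrite add0r. Qed.
Fact usa_addN : left_inverse usa_zero usa_opp usa_add.
Proof. by move=> x; apply: usa_val_inj => i /=; rewrite scaleN1r addNr. Qed.

HB.instance Definition _ :=
  GRing.isZmodule.Build T usa_addA usa_addC usa_add0 usa_addN.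

Fact usa_scaleA c1 c2 x : usa_scale c1 (usa_scale c2 x) = usa_scale (c1 * c2) x.
Proof. by apply: usa_val_inj => i /=; rewrite scalerA. Qed.
Fact usa_scale1 : left_id 1 usa_scale.
Proof. by move=> x; apply: usa_val_inj => i /=; rewrite scale1r. Qed.
Fact usa_scaleDr : right_distributive usa_scale +%R.
Proof. by move=> c x y; apply: usa_val_inj => i /=; rewrite scalerDr. Qed.
Fact usa_scaleDl x : {morph usa_scale^~ x : c1 c2 / c1 + c2}.
Proof. by move=> c1 c2; apply: usa_val_inj => i /=; rewrite scalerDl. Qed.

HB.instance Definition _ := GRing.Zmodule_isLmodule.Build R[i] T
  usa_scaleA usa_scale1 usa_scaleDr usa_scaleDl.

Lemma usa_addE x y i : (x + y) i = x i + y i. Proof. by []. Qed.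
Lemma usa_scaleE c x i : (c *: x) i = c *: x i. Proof. by []. Qed.
Lemma usa_zeroE i : (0 : T) i = 0. Proof. by []. Qed.
Lemma usa_oppE x i : (- x) i = - x i. Proof. by rewrite -[RHS]scaleN1r. Qed.
Lemma usa_subE x y i : (x - y) i = x i - y i.
Proof. by rewrite usa_addE usa_oppE. Qed.

Lemma usa_entry_bounded x : entry_bounded x.
Proof. exact: usa_bounded (usa_valP x). Qed.

Definition usa_norm x : R[i] := op_norm x.

Fact usa_normD x y : usa_norm (x + y) <= usa_norm x + usa_norm y.
Proof. exact: op_normD (usa_entry_bounded x) (usa_entry_bounded y). Qed.
Fact usa_normZ c x : usa_norm (c *: x) = `|c| * usa_norm x.
Proof. exact: op_normZ (usa_entry_bounded x). Qed.
Fact usa_norm_eq0 x : usa_norm x = 0 -> x = 0.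
Proof.
move=> /(op_norm_eq0 (usa_entry_bounded x)) x0.
by apply: usa_val_inj => i; rewrite x0.
Qed.

HB.instance Definition _ := Lmodule_isNormed.Build R[i] T
  usa_normD usa_normZ usa_norm_eq0.

Lemma usa_entry_le_norm x i p q : `|x i p q| <= `|x|.
Proof. exact: entry_le_op_norm (usa_entry_bounded x). Qed.

Lemma usa_norm_le x (c : R[i]) : 0 <= c -> (forall i p q, `|x i p q| <= c) ->
  `|x| <= c * (d * d)%:R.
Proof. exact: op_norm_entry_le. Qed.

End UsaAlgebra.

(** * Completeness and the C*-structure *)

Section UsaComplete.
Variables (R : realType) (I : Type) (d : nat) (P : uniform_star_algebra R I d).
Local Notation T := (usa_elt P).
Implicit Types (x y z : T) (c : R[i]).

(** Reduces completeness to that of [R]: it is applied to the real and imaginary parts of each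
    matrix entry. The error bound depends on the ball alone and not on [h], which makes the
    entrywise limits uniform. *)
Lemma cauchy_lipschitz_lim (F : set_system T) (h : T -> R) : ProperFilter F ->
  cauchy F -> (forall x y, (`|h x - h y|)%:C%C <= `|x - y|) ->
  exists l : R, forall x (e : R[i]), 0 < e -> F (ball x e) -> (`|l - h x|)%:C%C <= e.
Proof.
move=> FF /cauchyP Fc hL.
have near_h x (r : R) : F (ball x r%:C%C) -> \forall y \near F, `|h x - h y| < r.
  apply: filterS => y; rewrite -ball_normE /= => xy.
  by rewrite -ltcR; apply: le_lt_trans (hL x y) _.
have /cvg_ex[l hl] : cvg (h @ F).
  apply: cauchy_cvg; apply: cauchy_exP => r r0.
  have [|x Fx] := Fc r%:C%C; first by rewrite ltcR.
  by exists (h x); apply: filterS (near_h x r Fx) => y; rewrite -ball_normE.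
exists l => x e e0 Fx.
have er : e = (complex.Re e)%:C%C by rewrite RRe_real ?gtr0_real.
rewrite er lecR; apply/ler_addgt0Pl => s s0.
move/cvgrPdist_lt : hl => /(_ s s0) hl.
rewrite er in Fx; have [y [ly xy]] := filter_ex (filterI hl (near_h x _ Fx)).
rewrite -(subrK (h y) l) -addrA (le_trans (ler_normD _ _))//.
by rewrite lerD ?ltW// distrC.
Qed.

Lemma normc_ge_Im (z : R[i]) : (`|complex.Im z|)%:C%C <= `|z|.
Proof.
have := normc_ge_Re (z * 'i%C); rewrite ReiNIm normrN normrM.
suff -> : `|'i%C : R[i]| = 1 by rewrite mulr1.
by rewrite normc_def /= expr0n expr1n add0r sqrtr1.
Qed.

Lemma normc_le_Re_Im (z : R[i]) :
  `|z| <= (`|complex.Re z|)%:C%C + (`|complex.Im z|)%:C%C.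
Proof.
rewrite {1}[z]complexE; apply: le_trans (ler_normD _ _) _.
rewrite normrM !normc_def /= !expr0n !expr1n !addr0 add0r sqrtr1 mul1r.
by rewrite !sqrtr_sqr.
Qed.

Fact usa_complete (F : set_system T) : ProperFilter F -> cauchy F -> cvg F.
Proof.
move=> FF Fc.
have hR i p q x y :
    (`|complex.Re (x i p q) - complex.Re (y i p q)|)%:C%C <= `|x - y|.
  apply: le_trans (usa_entry_le_norm (x - y) i p q).
  rewrite usa_subE !mxE; apply: le_trans (normc_ge_Re _).
  by case: (x i p q) (y i p q) => [? ?] [? ?].
have hI i p q x y :
    (`|complex.Im (x i p q) - complex.Im (y i p q)|)%:C%C <= `|x - y|.
  apply: le_trans (usa_entry_le_norm (x - y) i p q).
  rewrite usa_subE !mxE; apply: le_trans (normc_ge_Im _).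
  by case: (x i p q) (y i p q) => [? ?] [? ?].
pose limR i p q := cid (cauchy_lipschitz_lim FF Fc (hR i p q)).
pose limI i p q := cid (cauchy_lipschitz_lim FF Fc (hI i p q)).
pose a i : 'M[R[i]]_d := \matrix_(p, q)
  Complex (sval (limR i p q)) (sval (limI i p q)).
have aF x (e : R[i]) : 0 < e -> F (ball x e) ->
    forall i p q, `|a i p q - x i p q| <= e + e.
  move=> e0 Fx i p q; rewrite mxE.
  case: (limR i p q) => lr /(_ x e e0 Fx) /= Hr.
  case: (limI i p q) => li /(_ x e e0 Fx) /= Hi.
  apply: le_trans (normc_le_Re_Im _) _.
  by move: Hr Hi; case: (x i p q) => [? ?] /= Hr Hi; exact: lerD.
have Pa : usa_mem P a.
  apply: usa_closed => e e0; have e20 : 0 < e / 2 by rewrite divr_gt0.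
  have [x Fx] := (cauchyP F).1 Fc _ e20.
  exists x; first exact: usa_valP.
  by move=> i p q; rewrite [leRHS]splitr; exact: aF.
apply/cvg_ex; exists (UsaElt Pa); apply/cvgrPdist_lt => e e0.
(* The entries of the limit and of [x] differ by at most [e' + e'], so the norm of their difference
   is at most [(e' + e') * (d * d)]; the distance from [x] to [y] adds one more [e']. *)
pose e' := e / ((d * d)%:R + (d * d)%:R + 1).
have D0 : 0 < ((d * d)%:R + (d * d)%:R + 1 : R[i]) by rewrite ltr_wpDl// addr_ge0.
have e'0 : 0 < e' by rewrite divr_gt0.
have [x Fx] := (cauchyP F).1 Fc _ e'0.
near=> y.
have xy : `|x - y| < e' by near: y; apply: filterS Fx => y; rewrite -ball_normE.
have -> : e = (e' + e') * (d * d)%:R + e'.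
  by rewrite mulrDl -!mulrDr -[X in _ * _ + X]mulr1 -mulrDr divfK ?gt_eqF.
rewrite -(subrK x (UsaElt Pa)) -addrA; apply: le_lt_trans (ler_normD _ _) _.
apply: ler_ltD => //; apply: usa_norm_le; first by rewrite addr_ge0 ?ltW.
by move=> i p q; rewrite usa_subE !mxE; have := aF _ _ e'0 Fx i p q; rewrite !mxE.
Unshelve. all: by end_near. Qed.

HB.instance Definition _ := Uniform_isComplete.Build T usa_complete.

Fact usa_mulA x y z : usa_mul x (usa_mul y z) = usa_mul (usa_mul x y) z.
Proof. by apply: usa_val_inj => i /=; rewrite mulmxA. Qed.
Fact usa_mulDl x y z : usa_mul (x + y) z = usa_mul x z + usa_mul y z.
Proof. by apply: usa_val_inj => i /=; rewrite mulmxDl. Qed.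
Fact usa_mulDr x y z : usa_mul x (y + z) = usa_mul x y + usa_mul x z.
Proof. by apply: usa_val_inj => i /=; rewrite mulmxDr. Qed.
Fact usa_mulZl c x y : usa_mul (c *: x) y = c *: usa_mul x y.
Proof. by apply: usa_val_inj => i /=; rewrite -scalemxAl. Qed.
Fact usa_mulZr c x y : usa_mul x (c *: y) = c *: usa_mul x y.
Proof. by apply: usa_val_inj => i /=; rewrite -scalemxAr. Qed.
Fact usa_starK x : usa_star (usa_star x) = x.
Proof. by apply: usa_val_inj => i /=; rewrite trmxCK. Qed.
Fact usa_starD x y : usa_star (x + y) = usa_star x + usa_star y.
Proof. by apply: usa_val_inj => i /=; rewrite linearD/= map_mxD. Qed.
Fact usa_starZ c x : usa_star (c *: x) = Num.conj c *: usa_star x.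
Proof. by apply: usa_val_inj => i /=; rewrite linearZ/= map_mxZ. Qed.
Fact usa_starM x y : usa_star (usa_mul x y) = usa_mul (usa_star y) (usa_star x).
Proof. by apply: usa_val_inj => i /=; rewrite trmx_mul map_mxM. Qed.
Fact usa_norm_mul x y : `|usa_mul x y| <= `|x| * `|y|.
Proof. exact: op_normM (usa_entry_bounded x) (usa_entry_bounded y). Qed.
Fact usa_norm_star_mul x : `|usa_mul (usa_star x) x| = `|x| ^+ 2.
Proof. exact: op_norm_cstar (usa_entry_bounded x). Qed.

HB.instance Definition _ := CompleteNormedModule_isCStarAlgebra.Build R T
  usa_mulA usa_mulDl usa_mulDr usa_mulZl usa_mulZr usa_starK usa_starD
  usa_starZ usa_starM usa_norm_mul usa_norm_star_mul.

Lemma usa_mulE x y i : cmul x y i = x i *m y i. Proof. by []. Qed.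
Lemma usa_starE x i : cstar x i = (x i)^t*. Proof. by []. Qed.

End UsaComplete.

(** * Functions vanishing at infinity *)

Lemma entry_mul_le (C : numClosedFieldType) (d : nat) (m n : 'M[C]_d) (c1 c2 : C) :
  (forall p q, `|m p q| <= c1) -> (forall p q, `|n p q| <= c2) ->
  forall p q, `|(m *m n) p q| <= c1 * c2 * d%:R.
Proof.
move=> mc nc p q; rewrite mxE; apply: le_trans (ler_norm_sum _ _ _) _.
rewrite mulr_natr -[X in _ *+ X]card_ord -sumr_const; apply: ler_sum => k _.
by rewrite normrM ler_pM.
Qed.

Section Summands.
Variable X : choiceType.

(* [inl x] is the one-dimensional summand attached to the point x, and
   [inr (x, y)] the summand of 2 x 2 matrices attached to the pair (x, y). *)
Definition summand : choiceType := (X + X * X)%type.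

(** A list without repetitions, not just a finite set: it also numbers the simple summands of the
    finite dimensional subalgebra attached to [E]. *)
Definition summands (E : {fset X}) : seq summand :=
  [seq inl x | x <- enum_fset E] ++
  [seq inr (x, y) | x <- enum_fset E, y <- enum_fset E].

Lemma mem_summands_inl E x : (inl x \in summands E) = (x \in E).
Proof.
rewrite mem_cat mem_map; last by move=> ? ? [].
by rewrite [X in _ || X](_ : _ = false) ?orbF//; apply/negP => /allpairsP[[y z] []].
Qed.

Lemma mem_summands_inr E x y :
  (inr (x, y) \in summands E) = (x \in E) && (y \in E).
Proof.
rewrite mem_cat (_ : _ \in map _ _ = false)/=; last by apply/negP => /mapP[].
apply/allpairsP/andP => [[[u v] /= [uE vE [-> ->]]]//|[xE yE]].
by exists (x, y).
Qed.

Lemma summands_uniq E : uniq (summands E).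
Proof.
rewrite cat_uniq map_inj_uniq ?fset_uniq/=; last by move=> ? ? [].
rewrite allpairs_uniq ?fset_uniq//; last by move=> [? ?] [? ?] _ _ [-> ->].
by rewrite andbT; apply/hasPn => _ /allpairsP[[u v] [_ _ ->]]; apply/negP => /mapP[].
Qed.

Lemma summandsS E F : {subset summands E <= summands F} <-> {subset E <= F}.
Proof.
split=> EF; [move=> x|move=> [x|[x y]]].
- by rewrite -mem_summands_inl => /EF; rewrite mem_summands_inl.
- by rewrite !mem_summands_inl; exact: EF.
- by rewrite !mem_summands_inr => /andP[/EF-> /EF->].
Qed.

End Summands.

Section Vanishing.
Variables (R : realType) (X : choiceType) (d : nat).
Local Notation T := (summand X).
Implicit Types a b : T -> 'M[R[i]]_d.

(** This is vanishing at infinity on the discrete set of summands: every finite set of summands is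
    contained in [summands E] for some finite [E]. *)
Definition vanishing a := forall e : R[i], 0 < e -> exists E : {fset X},
  forall t, t \notin summands E -> forall p q, `|a t p q| <= e.

Lemma vanishing_bounded a : vanishing a -> entry_bounded a.
Proof.
move=> /(_ 1 ltr01)[E aE].
pose N t := \sum_p \sum_q `|a t p q|.
have N0 t : 0 <= N t by apply: sumr_ge0 => p _; apply: sumr_ge0.
have aN t p q : `|a t p q| <= N t.
  rewrite /N (bigD1 p)//= (bigD1 q)//= -addrA lerDl addr_ge0//.
    by rewrite sumr_ge0.
  by apply: sumr_ge0 => ? _; apply: sumr_ge0.
exists (1 + \sum_(t <- summands E) N t) => t p q.
have [tE|tE] := boolP (t \in summands E).
  apply: le_trans (aN t p q) _; rewrite (big_rem t)//= addrCA lerDl addr_ge0//.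
  exact: sumr_ge0.
by apply: le_trans (aE t tE p q) _; rewrite lerDl sumr_ge0.
Qed.

Lemma summandsU_notin (E F : {fset X}) (t : T) : t \notin summands (E `|` F)%fset ->
  t \notin summands E /\ t \notin summands F.
Proof.
by move=> tEF; split; apply: contra tEF; move: t; apply/summandsS => x xE;
  rewrite inE xE ?orbT.
Qed.

Lemma vanishing_lin (c : R[i]) a b : vanishing a -> vanishing b ->
  vanishing (fun t => c *: a t + b t).
Proof.
move=> va vb e e0.
have c10 : 0 < `|c| + 1 by rewrite ltr_wpDl.
have [|E aE] := va (e / 2 / (`|c| + 1)); first by rewrite !divr_gt0.
have [|F bF] := vb (e / 2); first by rewrite divr_gt0.
exists (E `|` F)%fset => t /summandsU_notin[tE tF] p q.
rewrite !mxE [e]splitr; apply: le_trans (ler_normD _ _) _; apply: lerD; last exact: bF.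
rewrite normrM; apply: (@le_trans _ _ ((`|c| + 1) * (e / 2 / (`|c| + 1)))).
  by apply: ler_pM => //; [rewrite lerDl|exact: aE].
by rewrite mulrC divfK ?gt_eqF.
Qed.

Lemma vanishing0 : vanishing (fun=> 0).
Proof. by move=> e e0; exists fset0 => t _ p q; rewrite mxE normr0 ltW. Qed.

Lemma vanishingD a b : vanishing a -> vanishing b -> vanishing (fun t => a t + b t).
Proof.
move=> va vb; have := vanishing_lin 1 va vb; congr vanishing.
by apply/funext => t; rewrite scale1r.
Qed.

Lemma vanishing_star a : vanishing a -> vanishing (fun t => (a t)^t*).
Proof.
move=> va e e0; have [E aE] := va e e0; exists E => t tE p q.
by rewrite !mxE norm_conjC aE.
Qed.

Lemma entry_bounded_pos a : entry_bounded a ->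
  exists2 c : R[i], 0 < c & forall t p q, `|a t p q| <= c.
Proof.
move=> /entry_op_boundedP[c c0 ac]; exists (c + 1); first by rewrite ltr_wpDl.
move=> t p q; apply: le_trans (op_bounded_entry p q (ac t)) _.
by rewrite lerDl.
Qed.

Lemma small_product (c e : R[i]) : 0 < c -> 0 < e ->
  exists2 h : R[i], 0 < h & c * h * d%:R <= e /\ h * c * d%:R <= e.
Proof.
move=> c0 e0; have D0 : 0 < d%:R + 1 :> R[i] by rewrite ltr_wpDl.
(* Adding 1 keeps the denominator positive when [d] is 0. *)
exists (e / (c * (d%:R + 1))); first by rewrite divr_gt0// mulr_gt0.
rewrite [_ * c]mulrC mulrCA invfM mulVKf ?gt_eqF// mulrAC ler_pdivrMr//.
by rewrite ler_wpM2l ?lerDl// ltW.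
Qed.

Lemma vanishingMr a b : vanishing a -> entry_bounded b ->
  vanishing (fun t => a t *m b t).
Proof.
move=> va /entry_bounded_pos[c c0 bc] e e0.
have [h h0 [_ he]] := small_product c0 e0.
have [E aE] := va h h0; exists E => t tE p q; apply: le_trans he.
by apply: entry_mul_le => //; exact: aE.
Qed.

Lemma vanishingMl a b : vanishing b -> entry_bounded a ->
  vanishing (fun t => a t *m b t).
Proof.
move=> vb /entry_bounded_pos[c c0 ac] e e0.
have [h h0 [he _]] := small_product c0 e0.
have [E bE] := vb h h0; exists E => t tE p q; apply: le_trans he.
by apply: entry_mul_le => //; exact: bE.
Qed.

(** When (x, y) leaves a finite square, one of the two points leaves the finite set; its factor is
    then small while the other stays bounded. This disposes of the mixed terms in products of
    twisted families. *)
Lemma vanishing_cross a b (f : T -> 'M[R[i]]_d) : vanishing a -> vanishing b ->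
  (forall x, f (inl x) = 0) ->
  (forall x y, f (inr (x, y)) = a (inl x) *m b (inl y)) \/
  (forall x y, f (inr (x, y)) = a (inl y) *m b (inl x)) -> vanishing f.
Proof.
move=> va vb f0 fab e e0.
have [c c0 ac] := entry_bounded_pos (vanishing_bounded va).
have [c' c'0 bc] := entry_bounded_pos (vanishing_bounded vb).
have [h h0 [he _]] := small_product c0 e0.
have [h' h'0 [_ h'e]] := small_product c'0 e0.
have [E aE] := va h' h'0; have [F bF] := vb h h0.
exists (E `|` F)%fset => -[x _ p q|[x y]]; first by rewrite f0 mxE normr0 ltW.
rewrite mem_summands_inr negb_and => xy p q.
have key u v : (u \notin (E `|` F)%fset) || (v \notin (E `|` F)%fset) ->
    `|(a (inl u) *m b (inl v)) p q| <= e.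
  rewrite !inE !negb_or => /orP[/andP[uE _]|/andP[_ vF]].
    by apply: le_trans h'e; apply: entry_mul_le => //; apply: aE; rewrite mem_summands_inl.
  by apply: le_trans he; apply: entry_mul_le => //; apply: bF; rewrite mem_summands_inl.
by case: fab => ->; apply: key => //; rewrite orbC.
Qed.

End Vanishing.

(** * The twisted algebra *)

Section Corner.
Variable C : numClosedFieldType.
Implicit Types m n : 'M[C]_2.

(** Corner matrices are the multiples of e11. They encode the scalars at the points, so that all
    values of a family have the same type. *)
Definition corner m := forall p q, (p != 0) || (q != 0) -> m p q = 0.

Lemma cornerE m : corner m -> m = m 0 0 *: delta_mx 0 0.
Proof.
move=> cm; apply/matrixP => p q; rewrite !mxE.
have [/andP[/eqP-> /eqP->]|pq] := boolP ((p == 0) && (q == 0)).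
  by rewrite mulr1.
by rewrite mulr0 cm// -negb_and.
Qed.

Lemma corner0 : corner 0. Proof. by move=> p q _; rewrite mxE. Qed.

Lemma corner_lin (c : C) m n : corner m -> corner n -> corner (c *: m + n).
Proof. by move=> cm cn p q pq; rewrite !mxE cm// cn// mulr0 addr0. Qed.

Lemma cornerM m n : corner m -> corner n -> corner (m *m n).
Proof.
move=> cm cn p q pq; rewrite mxE big1// => k _.
by case/orP: pq => h; [rewrite cm ?h ?mul0r|rewrite (cn k) ?h ?orbT ?mulr0].
Qed.

Lemma corner_star m : corner m -> corner (m^t*).
Proof. by move=> cm p q pq; rewrite !mxE cm ?conjC0// orbC. Qed.

Lemma corner_comm m n : corner m -> corner n -> m *m n = n *m m.
Proof.
move=> /cornerE-> /cornerE->.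
by rewrite -!scalemxAl -!scalemxAr !scalerA mulrC.
Qed.

End Corner.

Section Twist.
Variables (R : realType) (X : choiceType) (V : 'M[R[i]]_2).
Hypothesis V_unitary : V \is unitarymx.
Local Notation T := (summand X).
Implicit Types (a b : T -> 'M[R[i]]_2) (m n : 'M[R[i]]_2) (E F : {fset X}).

Definition conjV m := V *m m *m V^t*.

Fact conjV_is_linear : linear conjV.
Proof. by move=> c m n; rewrite /conjV mulmxDr mulmxDl -scalemxAr -scalemxAl. Qed.
HB.instance Definition _ := GRing.isLinear.Build R[i] 'M[R[i]]_2 'M[R[i]]_2 _
  conjV conjV_is_linear.

Lemma conjVB m n : conjV (m - n) = conjV m - conjV n.
Proof. by rewrite /conjV mulmxBr mulmxBl. Qed.

Lemma conjVM m n : conjV (m *m n) = conjV m *m conjV n.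
Proof. by rewrite /conjV !mulmxA mulmxKtV. Qed.

Lemma conjV_star m : conjV (m^t*) = (conjV m)^t*.
Proof. by rewrite /conjV !trmx_mul !map_mxM trmxCK mulmxA. Qed.

(** Both V and V^* have operator bound 1, and 4 = 2 * 2 is the cost of passing from entries to the
    operator bound. *)
Lemma conjV_entry_le m (c : R[i]) : 0 <= c -> (forall p q, `|m p q| <= c) ->
  forall p q, `|conjV m p q| <= c * 4.
Proof.
move=> c0 mc p q; have V1 n : n \is unitarymx -> op_bounded 1 n.
  move=> /unitarymxP nn; rewrite -sqrtC1; apply: op_bounded_sqrtC => // v.
  by rewrite nn mulmx1 mul1r.
apply: op_bounded_entry; rewrite -[_ * 4]mulr1; apply: op_boundedM => //; last first.
  by apply: V1; rewrite trmxC_unitary.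
rewrite -[_ * 4]mul1r; apply: op_boundedM; rewrite ?mulr_ge0//; first exact: V1.
exact: (entry_op_bounded c0 mc).
Qed.

(* The value at [(x, y)] forced by the values at [x] and [y]: the point [x]
   acts through the first basis vector, [y] through its image under [V]. *)
Definition twist a (t : T) : 'M[R[i]]_2 :=
  match t with
  | inl _ => 0
  | inr (x, y) => a (inl x) + conjV (a (inl y))
  end.

(** At a point the defect is the value itself, so vanishing of the defect expresses at once that the
    scalars tend to 0 and that the blocks approach their twisted values. *)
Definition defect a (t : T) := a t - twist a t.

Lemma twist_lin (c : R[i]) a b t :
  twist (fun t => c *: a t + b t) t = c *: twist a t + twist b t.
Proof.
case: t => [x|[x y]] /=; first by rewrite scaler0 addr0.
by rewrite linearP /= scalerDr addrACA.
Qed.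

Lemma defect_lin (c : R[i]) a b t :
  defect (fun t => c *: a t + b t) t = c *: defect a t + defect b t.
Proof. by rewrite /defect twist_lin opprD addrACA scalerBr. Qed.

Lemma twist_entry_le a (c : R[i]) : 0 <= c ->
  (forall x p q, `|a (inl x) p q| <= c) -> forall t p q, `|twist a t p q| <= c * 5.
Proof.
move=> c0 ac [x|[x y]] p q /=; first by rewrite mxE normr0 mulr_ge0.
rewrite mxE; apply: le_trans (ler_normD _ _) _.
rewrite (_ : 5 = 1 + 4)// mulrDr mulr1 lerD//; last exact: conjV_entry_le.
Qed.

(** The factor 6 is 1 for [a] plus 5 = 1 + 4 for the two terms of the twist. *)
Lemma defect_entry_le a (c : R[i]) : 0 <= c ->
  (forall t p q, `|a t p q| <= c) -> forall t p q, `|defect a t p q| <= c * 6.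
Proof.
move=> c0 ac t p q; rewrite !mxE; apply: le_trans (ler_normB _ _) _.
rewrite (_ : 6 = 1 + 5); last by rewrite -(natrD _ 1 5).
rewrite mulrDr mulr1 lerD//; apply: twist_entry_le => // x; exact: ac.
Qed.

Definition twisted_mem : set (T -> 'M[R[i]]_2) :=
  [set a | (forall x, corner (a (inl x))) /\ vanishing (defect a)].

Lemma defect_inl a x : defect a (inl x) = a (inl x).
Proof. by rewrite /defect subr0. Qed.

Definition points a (t : T) : 'M[R[i]]_2 := if t is inl x then a (inl x) else 0.

Lemma points_vanishing a : vanishing (defect a) -> vanishing (points a).
Proof.
move=> va e e0; have [E aE] := va e e0; exists E => -[x|z] tE p q /=.
  by rewrite -defect_inl aE.
by rewrite mxE normr0 ltW.
Qed.

Lemma points_entry_bounded a : vanishing (defect a) ->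
  exists2 c : R[i], 0 <= c & forall x p q, `|a (inl x) p q| <= c.
Proof.
move=> /points_vanishing/vanishing_bounded/entry_bounded_pos[c c0 ac].
by exists c => [|x]; [exact: ltW|exact: (ac (inl x))].
Qed.

Lemma twist_bounded a : vanishing (defect a) -> entry_bounded (twist a).
Proof.
move=> /points_entry_bounded[c c0 ac]; exists (c * 5); exact: twist_entry_le.
Qed.

Lemma twisted_bounded a : twisted_mem a -> entry_bounded a.
Proof.
move=> [_ va]; have [c ac] := twist_bounded va.
have [c' ac'] := vanishing_bounded va; exists (c' + c) => t p q.
rewrite -[a t](subrK (twist a t)) mxE; apply: le_trans (ler_normD _ _) _.
by apply: lerD; [exact: ac'|exact: ac].
Qed.

Fact twisted0 : twisted_mem (fun=> 0).
Proof.
split=> [x|]; first exact: corner0.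
have := @vanishing0 R X 2; congr vanishing; apply/funext => -[x|[x y]].
  by rewrite defect_inl.
by rewrite /defect /= linear0 addr0 subr0.
Qed.

Fact twistedP (c : R[i]) a b : twisted_mem a -> twisted_mem b ->
  twisted_mem (fun t => c *: a t + b t).
Proof.
move=> [ca va] [cb vb]; split=> [x|]; first exact: corner_lin.
have := vanishing_lin c va vb; congr vanishing; apply/funext => t.
by rewrite defect_lin.
Qed.

Fact twistedS a : twisted_mem a -> twisted_mem (fun t => (a t)^t*).
Proof.
move=> [ca va]; split=> [x|]; first exact: corner_star.
have := vanishing_star va; congr vanishing; apply/funext => t.
rewrite /defect linearB/= map_mxB; congr (_ - _).
case: t => [x|[x y]] /=; first by rewrite trmx0 map_mx0.
by rewrite linearD/= map_mxD conjV_star.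
Qed.

Lemma conjV_vanishing a : vanishing a -> vanishing (fun t => conjV (a t)).
Proof.
move=> va e e0; have [|E aE] := va (e / 4); first by rewrite divr_gt0.
exists E => t tE p q; rewrite -[leRHS](divfK (_ : 4 != 0))//.
by apply: conjV_entry_le; [rewrite divr_ge0// ltW|exact: aE].
Qed.

(* With [a_xy = u + u' + r], [b_xy = v + v' + s] for the twisted values and the
   defects, [a_xy b_xy - u v - u' v' = r b_xy + (u + u') s + u v' + u' v]. *)
Fact twistedM a b : twisted_mem a -> twisted_mem b ->
  twisted_mem (fun t => a t *m b t).
Proof.
move=> ma mb; have [ca va] := ma; have [cb vb] := mb.
split=> [x|]; first exact: cornerM.
have pa := points_vanishing va; have pb := points_vanishing vb.
pose cross1 (t : T) : 'M[R[i]]_2 :=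
  if t is inr (x, y) then a (inl x) *m conjV (b (inl y)) else 0.
pose cross2 (t : T) : 'M[R[i]]_2 :=
  if t is inr (x, y) then conjV (a (inl y)) *m b (inl x) else 0.
have v1 : vanishing (fun t => defect a t *m b t).
  exact: vanishingMr va (twisted_bounded mb).
have v2 : vanishing (fun t => twist a t *m defect b t).
  exact: vanishingMl vb (twist_bounded va).
have v3 : vanishing cross1.
  by apply: (vanishing_cross pa (conjV_vanishing pb)) => //; left.
have v4 : vanishing cross2.
  by apply: (vanishing_cross (conjV_vanishing pa) pb) => //; right.
have := vanishingD (vanishingD v1 v2) (vanishingD v3 v4).
congr vanishing; apply/funext => -[x|[x y]].
  by rewrite /= !addr0 /defect /= !subr0 mul0mx addr0.
rewrite /defect /= conjVM; move: (a (inr _)) (b (inr _)) => a_xy b_xy.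
rewrite mulmxBl mulmxBr [X in X + _]addrA subrK -addrA; congr (_ + _).
rewrite mulmxDl !mulmxDr [conjV (a (inl y)) *m b (inl x) + _]addrC.
by rewrite [X in - X + _]addrACA opprD addrNK.
Qed.

Fact twisted_closed a :
  (forall e : R[i], 0 < e ->
    exists2 b, twisted_mem b & forall t p q, `|a t p q - b t p q| <= e) ->
  twisted_mem a.
Proof.
move=> happrox; split=> [x p q pq|e e0].
  apply/eqP; rewrite -normr_eq0 eq_le normr_ge0 andbT; apply/ler_addgt0Pl => e e0.
  rewrite addr0.
  have [b [cb _] ab] := happrox e e0.
  by have := ab (inl x) p q; rewrite (cb x p q pq) subr0.
(* The defect enlarges entries at most sixfold, which leaves [e / 2] for the defect of [b]. *)
have e12 : 0 < e / 12 by rewrite divr_gt0.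
have [b [_ vb] ab] := happrox _ e12.
have [|E bE] := vb (e / 2); first by rewrite divr_gt0.
exists E => t tE p q; rewrite (_ : a = fun t => 1 *: (a t - b t) + b t); last first.
  by apply/funext => u; rewrite scale1r subrK.
rewrite defect_lin scale1r mxE [e]splitr; apply: le_trans (ler_normD _ _) _.
apply: lerD; last exact: bE.
have -> : e / 2 = e / 12 * 6.
  have -> : 12 = 2 * 6 :> R[i] by rewrite -natrM.
  by rewrite invfM mulrA divfK// pnatr_eq0.
apply: (@defect_entry_le (fun t => a t - b t)) => [|u i j]; first exact: ltW.
by rewrite !mxE; exact: ab.
Qed.

Definition twisted_algebra : uniform_star_algebra R T 2 :=
  UniformStarAlgebra twisted_bounded twisted0 twistedP twistedM twistedS
    twisted_closed.

End Twist.

(** * Finite dimensional subalgebras *)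

Section LocalSubalgebras.
Variables (R : realType) (X : choiceType) (V : 'M[R[i]]_2).
Hypothesis V_unitary : V \is unitarymx.
Local Notation T := (summand X).
Local Notation A := (usa_elt (twisted_algebra X V_unitary)).
Implicit Types (b : T -> 'M[R[i]]_2) (E F : {fset X}).

Lemma twisted_corner (a : A) x : corner (a (inl x)).
Proof. exact: (usa_valP a).1. Qed.

Definition local_subalgebra E : set A :=
  [set a | forall t, t \notin summands E -> defect V a t = 0].

Lemma finite_defect_mem E b : (forall x, corner (b (inl x))) ->
  (forall t, t \notin summands E -> defect V b t = 0) -> twisted_mem V b.
Proof.
move=> cb b0; split=> // e e0; exists E => t tE p q.
by rewrite b0// mxE normr0 ltW.
Qed.

Definition cut E b (t : T) := if t \in summands E then b t else 0.

(** Extends arbitrary values on the summands of [E] by the twist of their point values, so that the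
    defect is 0 elsewhere. The elements local over [E] are exactly these extensions. *)
Definition glue E b (t : T) :=
  if t \in summands E then b t else twist V (cut E b) t.

Lemma glue_in E b t : t \in summands E -> glue E b t = b t.
Proof. by rewrite /glue => ->. Qed.

Lemma glue_notin E b t : t \notin summands E -> glue E b t = twist V (cut E b) t.
Proof. by rewrite /glue => /negbTE->. Qed.

Lemma glue_inl E b x : glue E b (inl x) = cut E b (inl x).
Proof. by []. Qed.

Lemma twist_glue E b t : twist V (glue E b) t = twist V (cut E b) t.
Proof. by case: t => [x|[x y]]. Qed.

Lemma defect_glue E b t : t \notin summands E -> defect V (glue E b) t = 0.
Proof. by move=> tE; rewrite /defect twist_glue /glue (negbTE tE) subrr. Qed.

Lemma glue_mem E b : (forall x, corner (b (inl x))) -> twisted_mem V (glue E b).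
Proof.
move=> cb; apply: (@finite_defect_mem E) => [x|]; last exact: defect_glue.
by rewrite glue_inl /cut; case: ifP => _; [exact: cb|exact: corner0].
Qed.

Definition glued E b (cb : forall x, corner (b (inl x))) : A :=
  @UsaElt _ _ _ (twisted_algebra X V_unitary) _ (glue_mem E cb).

Lemma glued_local E b (cb : forall x, corner (b (inl x))) :
  local_subalgebra E (glued E cb).
Proof. by move=> t tE; exact: defect_glue. Qed.

Lemma local_inl E (a : A) x : local_subalgebra E a -> x \notin E -> a (inl x) = 0.
Proof. by move=> aE xE; rewrite -(defect_inl V) aE// mem_summands_inl. Qed.

Lemma local_twist E (a : A) t : local_subalgebra E a -> t \notin summands E ->
  a t = twist V a t.
Proof. by move=> aE tE; apply/eqP; rewrite -subr_eq0; apply/eqP; exact: aE. Qed.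

Lemma glue_local E (a : A) b : local_subalgebra E a ->
  (forall t, t \in summands E -> b t = a t) -> forall t, glue E b t = a t.
Proof.
move=> aE ba t; rewrite /glue; have [tE|tE] := boolP (t \in summands E); first exact: ba.
have ca x : cut E b (inl x) = a (inl x).
  rewrite /cut; case: ifPn => [/ba//|]; rewrite mem_summands_inl => xE.
  by rewrite (local_inl aE).
rewrite (local_twist aE tE); case: t {tE} => [x//|[x y]] /=.
by rewrite !ca.
Qed.

Lemma cut_notin E b x : x \notin E -> cut E b (inl x) = 0.
Proof. by move=> xE; rewrite /cut mem_summands_inl (negbTE xE). Qed.

(** A pair outside the square of [E] has a coordinate outside [E], so at most one of the two terms
    of the twist survives. No cross terms appear, and each term alone is multiplicative. *)
Lemma glueM E b b' t : glue E (fun t => b t *m b' t) t = glue E b t *m glue E b' t.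
Proof.
have [tE|tE] := boolP (t \in summands E); first by rewrite !glue_in.
rewrite !glue_notin//.
have cM x : cut E (fun t => b t *m b' t) (inl x) = cut E b (inl x) *m cut E b' (inl x).
  by rewrite /cut; case: ifP => _; rewrite ?mul0mx.
case: t tE => [x _|[x y]] /=; first by rewrite mul0mx.
rewrite mem_summands_inr negb_and !cM conjVM// => /orP[xE|yE].
  by rewrite !(cut_notin _ xE) mul0mx !add0r.
by rewrite !(cut_notin _ yE) /conjV !(mulmx0, mul0mx) !addr0.
Qed.

Lemma glue_lin E (c : R[i]) b b' t :
  glue E (fun t => c *: b t + b' t) t = c *: glue E b t + glue E b' t.
Proof.
have [tE|tE] := boolP (t \in summands E); first by rewrite !glue_in.
rewrite !glue_notin// -twist_lin.
have cl x : cut E (fun t => c *: b t + b' t) (inl x) =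
    c *: cut E b (inl x) + cut E b' (inl x).
  by rewrite /cut; case: ifP => _; rewrite ?scaler0 ?addr0.
by case: t tE => [//|[x y] _] /=; rewrite !cl.
Qed.

Lemma glue_star E b t : glue E (fun t => (b t)^t*) t = (glue E b t)^t*.
Proof.
have [tE|tE] := boolP (t \in summands E); first by rewrite !glue_in.
rewrite !glue_notin//.
have cs x : cut E (fun t => (b t)^t*) (inl x) = (cut E b (inl x))^t*.
  by rewrite /cut; case: ifP => _; rewrite ?trmx0 ?map_mx0.
case: t tE => [x _|[x y] _] /=; first by rewrite trmx0 map_mx0.
by rewrite !cs conjV_star -map_mxD -linearD.
Qed.

(** Local elements are fixed by [glue], which respects products and adjoints. The set is closed
    because the entries of the defect are at most six times the norm. *)
Lemma local_subalgebra_cstar E : cstar_subalgebra (local_subalgebra E).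
Proof.
split.
- move=> [x|[x y]] _; rewrite /defect /twist !usa_zeroE ?subr0//.
  by rewrite /conjV mulmx0 mul0mx addr0 subr0.
- by move=> c x y xE yE t tE; rewrite defect_lin xE// yE// scaler0 addr0.
- move=> x y xE yE t tE.
  have e : (cmul x y : T -> _) = glue E (fun t => x t *m y t).
    by apply/funext => u; rewrite glueM (glue_local xE)// (glue_local yE).
  by rewrite e defect_glue.
- move=> x xE t tE.
  have e : (cstar x : T -> _) = glue E (fun t => (x t)^t*).
    by apply/funext => u; rewrite glue_star (glue_local xE).
  by rewrite e defect_glue.
move=> a clE t tE; apply/matrixP => p q; rewrite [RHS]mxE.
apply/eqP; rewrite -normr_eq0 eq_le normr_ge0 andbT; apply/ler_addgt0Pl => e e0.
rewrite addr0; have e60 : 0 < e / 6 by rewrite divr_gt0.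
have [b [bE]] := clE _ (nbhsx_ballx a (e / 6) e60).
rewrite -ball_normE /= => ab.
have -> : (a : T -> _) = fun t => 1 *: (a - b) t + b t.
  by apply/funext => u; rewrite scale1r usa_subE subrK.
rewrite defect_lin scale1r bE// addr0.
rewrite -[leRHS](divfK (_ : 6 != 0)) ?pnatr_eq0//.
apply: (@defect_entry_le _ _ _ V_unitary (a - b)) => [|u i j]; first exact: ltW.
by apply: le_trans (usa_entry_le_norm _ _ _ _) _; exact: ltW.
Qed.

Definition point_projection_val x (t : T) : 'M[R[i]]_2 :=
  if t == inl x then delta_mx 0 0 else 0.

Lemma point_projection_corner x y : corner (point_projection_val x (inl y)).
Proof.
rewrite /point_projection_val; case: ifP => _; last exact: corner0.
by move=> p q; rewrite mxE -negb_and => /negbTE->.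
Qed.

(** Its value is e11 at the point x and at pairs (x, y), and V e11 V^* at pairs (y, x), for y
    different from x; at (x, x) it is 0. *)
Definition point_projection x : A := glued [fset x]%fset (point_projection_corner x).

Lemma point_projection_inl x y :
  point_projection x (inl y) = if y == x then delta_mx 0 0 else 0.
Proof.
rewrite /= glue_inl /cut mem_summands_inl inE /point_projection_val.
by case: (eqVneq y x) => [->|//]; rewrite eqxx.
Qed.

(** A point x of [E] outside [F] is detected by its projection, which is local over [E] but nonzero
    at x. *)
Lemma local_subalgebraS E F :
  local_subalgebra E `<=` local_subalgebra F <-> {subset E <= F}.
Proof.
split=> [EF x xE|EF a aE t tF]; last first.
  by apply: aE; apply: contra tF; move: t; apply/summandsS.
have pE : local_subalgebra E (point_projection x).
  move=> t tE; apply: glued_local; apply: contra tE; move: t.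
  by apply/summandsS => y; rewrite inE => /eqP->.
apply/negPn/negP => xF; have := local_inl (EF _ pE) xF.
rewrite point_projection_inl eqxx => /matrixP/(_ 0 0); rewrite !mxE/= => /eqP.
by rewrite oner_eq0.
Qed.

Lemma local_subalgebra_inj : injective local_subalgebra.
Proof.
by move=> E F EF; apply/fsetP => x; apply/idP/idP; apply/local_subalgebraS: x;
  rewrite EF.
Qed.

Lemma local_subalgebra_dense (a : A) (e : R[i]) : 0 < e ->
  exists E, exists2 b, local_subalgebra E b & `|a - b| < e.
Proof.
(* The entries of the difference are at most [6 * h], hence its norm is at most [24 * h], which is
   half of [e]. *)
move=> e0; pose h := e / 48; have h0 : 0 < h by rewrite divr_gt0.
have [E aE] := (usa_valP a).2 h h0.
exists E, (glued E (twisted_corner a)); first exact: glued_local.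
apply: (@le_lt_trans _ _ (h * 6 * (2 * 2)%:R)); last first.
  by rewrite /h -!mulrA gtr_pMr// -!natrM mulrC ltr_pdivrMr// mul1r ltr_nat.
have ac x p q : `|(a (inl x) - cut E a (inl x)) p q| <= h.
  rewrite /cut; case: ifPn => xE; first by rewrite subrr mxE normr0 ltW.
  by rewrite subr0 -(defect_inl V) aE.
apply: usa_norm_le => [|t p q]; first by rewrite mulr_ge0// ltW.
rewrite usa_subE /= /glue; case: ifPn => tE; first by rewrite subrr mxE normr0 mulr_ge0// ltW.
(* Outside the square the error is the defect, of size [h], plus the twist of the discarded point
   values, of size [5 * h]. *)
have -> : a t - twist V (cut E a) t =
    defect V a t + twist V (fun t => a t - cut E a t) t.
  rewrite /defect -addrA; congr (_ + _).
  case: t {tE} => [x|[x y]] /=; first by rewrite addr0.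
  by rewrite conjVB addrACA -opprD addKr.
rewrite mxE; apply: le_trans (ler_normD _ _) _.
rewrite (_ : 6 = 1 + 5); last by rewrite -(natrD _ 1 5).
rewrite mulrDr mulr1 lerD ?aE//.
by apply: (@twist_entry_le _ _ _ V_unitary (fun t => a t - cut E a t));
  [exact: ltW|exact: ac].
Qed.

End LocalSubalgebras.

(** * Multiplicities *)

Section Padding.
Variable C : numClosedFieldType.

(** The upper left corner, truncated or filled up with zeros. Resizing between arbitrary sizes
    avoids casts along equalities of dimensions. *)
Definition pad n m (A : 'M[C]_n) : 'M[C]_m := \matrix_(p, q)
  if (insub (val p) : option 'I_n, insub (val q) : option 'I_n) is
    (Some p', Some q') then A p' q' else 0.

Lemma pad_lin n m c (A B : 'M[C]_n) :
  pad m (c *: A + B) = c *: pad m A + pad m B.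
Proof.
apply/matrixP => p q; rewrite !mxE.
by move: (insub (val p) : option 'I_n) (insub (val q) : option 'I_n) => [?|] [?|];
  rewrite ?mxE// mulr0 addr0.
Qed.

Lemma pad0 n m : pad m (0 : 'M[C]_n) = 0.
Proof.
apply/matrixP => p q; rewrite !mxE.
by move: (insub (val p) : option 'I_n) (insub (val q) : option 'I_n) => [?|] [?|];
  rewrite ?mxE.
Qed.

Lemma pad_star n m (A : 'M[C]_n) : pad m (A^t*) = (pad m A)^t*.
Proof.
apply/matrixP => p q; rewrite !mxE.
by move: (insub (val p) : option 'I_n) (insub (val q) : option 'I_n) => [?|] [?|];
  rewrite ?mxE ?conjC0.
Qed.

Lemma pad_widen n m (nm : (n <= m)%N) (A : 'M[C]_n) p q :
  pad m A (widen_ord nm p) (widen_ord nm q) = A p q.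
Proof. by rewrite mxE /= !valK. Qed.

Lemma pad_out n m (A : 'M[C]_n) (p q : 'I_m) : (n <= p)%N || (n <= q)%N ->
  pad m A p q = 0.
Proof.
move=> pq; rewrite mxE; case: insubP => [? pn _|//]; case: insubP => [? qn _|//].
by move: pq; rewrite leqNgt pn leqNgt qn.
Qed.

Lemma padM n m (A B : 'M[C]_n) : (n <= m)%N -> pad m (A *m B) = pad m A *m pad m B.
Proof.
move=> nm; apply/matrixP => p q; rewrite [RHS]mxE.
have [pn|pn] := ltnP p n; last first.
  by rewrite pad_out ?pn// big1// => k _; rewrite pad_out ?pn// mul0r.
have [qn|qn] := ltnP q n; last first.
  by rewrite pad_out ?qn ?orbT// big1// => k _; rewrite mulrC pad_out ?qn ?orbT// mul0r.
have -> : p = widen_ord nm (Ordinal pn) by exact/val_inj.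
have -> : q = widen_ord nm (Ordinal qn) by exact/val_inj.
rewrite pad_widen mxE (bigID (fun k : 'I_m => (k < n)%N))/= [X in _ + X]big1 ?addr0.
  rewrite (big_ord_narrow nm); apply: eq_bigr => k _.
  by rewrite !pad_widen.
by move=> k; rewrite -leqNgt => nk; rewrite pad_out ?mul0r// nk orbT.
Qed.

Lemma pad_pad n k m (A : 'M[C]_n) : (n <= k)%N -> pad m (pad k A) = pad m A.
Proof.
move=> nk; apply/matrixP => p q.
have [pq|/norP[]] := boolP ((n <= p)%N || (n <= q)%N).
  rewrite [RHS]pad_out// mxE; case: insubP => [p' _ p'E|//].
  by case: insubP => [q' _ q'E|//]; rewrite pad_out// p'E q'E.
rewrite -!ltnNge => pn qn; rewrite !mxE.
have h (r : 'I_m) (rn : (r < n)%N) : insub (val r) = Some (widen_ord nk (Ordinal rn)).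
  by rewrite insubT ?(leq_trans rn)//= => ?; congr Some; exact/val_inj.
by rewrite !h pad_widen !insubT.
Qed.

Lemma pad_id n (A : 'M[C]_n) : pad n A = A.
Proof. by apply/matrixP => p q; rewrite mxE !valK. Qed.

Lemma pad_castmx n k m (e : n = k) (A : 'M[C]_n) :
  pad m (castmx (e, e) A) = pad m A.
Proof. by case: k / e; rewrite castmx_id. Qed.

Lemma pad_block n k m (A : 'M[C]_n) : pad m (block_mx A 0 0 (0 : 'M[C]_k)) = pad m A.
Proof.
apply/matrixP => p q; rewrite [LHS]mxE.
have [pq|/norP[]] := boolP ((n <= p)%N || (n <= q)%N).
  rewrite pad_out//; case: insubP => [p' _ p'E|//]; case: insubP => [q' _ q'E|//].
  move: pq; rewrite -p'E -q'E; case: (split_ordP p') => u ->;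
    case: (split_ordP q') => v ->; rewrite ?block_mxEul ?block_mxEur ?block_mxEdl
      ?block_mxEdr ?mxE//=.
  by rewrite leqNgt ltn_ord leqNgt ltn_ord.
rewrite -!ltnNge => pn qn; rewrite [RHS]mxE.
rewrite !insubT ?ltn_addr// => pk qk /=.
rewrite -(block_mxEul A 0 0 (0 : 'M[C]_k)); congr (_ _ _); exact/val_inj.
Qed.

Lemma pad_corner (A : 'M[C]_1) : corner (pad 2 A).
Proof.
by move=> p q pq; apply: pad_out; move: pq; rewrite -!lt0n.
Qed.

Lemma corner_padK (A : 'M[C]_2) : corner A -> pad 2 (pad 1 A) = A.
Proof.
move=> cA; apply/matrixP => p q.
have [pq|] := boolP ((p != 0) || (q != 0)).
  by rewrite cA//; apply: pad_out; move: pq; rewrite -!lt0n.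
rewrite negb_or !negbK => /andP[/eqP-> /eqP->].
have -> : 0 = widen_ord (isT : (1 <= 2)%N) 0 :> 'I_2 by exact/val_inj.
rewrite pad_widen mxE /= !insubT//=.
by congr (A _ _); exact/val_inj.
Qed.

End Padding.

Section Multiplicity.
Variable R : realType.

(** All multiplicities in the diagrams are 0 or 1, hence the boolean. A single copy followed by a
    zero block is a padded matrix. *)
Lemma has_multiplicity_le1 (n m : nat) (l : bool) (U : 'M[R[i]]_m)
    (phi : 'M[R[i]]_n -> 'M[R[i]]_m) : (l -> n <= m)%N -> U \is unitarymx ->
  (forall a, phi a = if l then U *m pad m a *m U^t* else 0) ->
  has_multiplicity phi l.
Proof.
move=> nm unitaryU phiE.
have e : (\sum_(i < l) n + (m - l * n) = m)%N.
  rewrite sum_nat_const card_ord subnKC//.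
  by case: (l) nm; rewrite ?mul0n// mul1n; apply.
exists (m - l * n)%N, e, U; split=> // a; rewrite phiE.
rewrite -[castmx _ _]pad_id pad_castmx pad_block.
have dim0 (D : 'M[R[i]]_(\sum_(i < 0) n)) : D = 0.
  by apply/matrixP => p q; have : (p < 0)%N
    by apply: leq_trans (ltn_ord p) _; rewrite big_ord0.
clear e; case: l {phiE nm} => /=; last by rewrite [mxdiag _]dim0 pad0 mulmx0 mul0mx.
by rewrite mxdiag_recl pad_castmx [mxdiag _]dim0 pad_block.
Qed.

End Multiplicity.

(** * Local subalgebras as direct sums of matrix algebras, and their inclusions *)

Section LocalIso.
Variables (R : realType) (X : choiceType) (V : 'M[R[i]]_2).
Hypothesis V_unitary : V \is unitarymx.
Local Notation T := (summand X).
Local Notation A := (usa_elt (twisted_algebra X V_unitary)).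
Local Notation local_sub := (@local_subalgebra R X V V_unitary).
Implicit Types (E F : {fset X}).

Definition summand_size (t : T) : nat := if t is inl _ then 1 else 2.

Definition local_summand E (i : 'I_(size (summands E))) : T :=
  tnth (in_tuple (summands E)) i.

Definition local_size E (i : 'I_(size (summands E))) : nat :=
  summand_size (local_summand i).

Lemma summand_size_le2 t : (summand_size t <= 2)%N.
Proof. by case: t. Qed.

Lemma local_summand_in E (i : 'I_(size (summands E))) : local_summand i \in summands E.
Proof. exact: mem_tnth. Qed.

Lemma summand_eq_local E t : t \in summands E ->
  exists i : 'I_(size (summands E)), t = local_summand i.
Proof. by move=> tE; have /tnthP := (tE : t \in in_tuple (summands E)). Qed.

Lemma local_summand_inj E : injective (@local_summand E).
Proof. exact/tuple_uniqP/summands_uniq. Qed.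

Section Spread.
Variable E : {fset X}.
Implicit Types x y : multimx R (@local_size E).

(** The sum has at most one term, as [summands E] has no repetitions; written this way, no index of
    [t] has to be chosen. *)
Definition spread x (t : T) : 'M[R[i]]_2 :=
  \sum_(i | local_summand i == t) pad 2 (x i).

Lemma spread_summand x i : spread x (local_summand i) = pad 2 (x i).
Proof.
rewrite /spread (big_pred1 i)// => j.
by apply/eqP/eqP => [/local_summand_inj|->].
Qed.

Lemma spread_notin x t : t \notin summands E -> spread x t = 0.
Proof.
move=> tE; rewrite /spread big_pred0// => i; apply/negP => /eqP it.
by move: tE; rewrite -it local_summand_in.
Qed.

Lemma spread_corner x (y : X) : corner (spread x (inl y)).
Proof.
have [/summand_eq_local[i it]|yE] := boolP (inl y \in summands E); last first.
  by rewrite spread_notin//; exact: corner0.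
rewrite it spread_summand; move: (x i); rewrite /local_size -it /=.
exact: pad_corner.
Qed.

Definition local_iso x : A := glued V_unitary E (spread_corner x).

Lemma local_iso_local x : local_sub E (local_iso x).
Proof. exact: glued_local. Qed.

Lemma local_isoE x t : local_iso x t = glue V E (spread x) t.
Proof. by []. Qed.

Lemma local_iso_summand x i : local_iso x (local_summand i) = pad 2 (x i).
Proof. by rewrite local_isoE glue_in ?local_summand_in// spread_summand. Qed.

Lemma pad_summand (a : A) t : pad 2 (pad (summand_size t) (a t)) = a t.
Proof.
case: t => [x|xy] /=; last by rewrite !pad_id.
by apply: corner_padK; exact: twisted_corner.
Qed.

Definition local_coords (a : A) : multimx R (@local_size E) :=
  fun i => pad (local_size i) (a (local_summand i)).

Lemma local_coordsK a : local_sub E a -> local_iso (local_coords a) = a.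
Proof.
move=> aE; apply: usa_val_inj => t; rewrite local_isoE; move: t.
apply: (glue_local aE) => t /summand_eq_local[i ->].
by rewrite spread_summand pad_summand.
Qed.

(** Gluing commutes with the operations, so these are compared on the summands of [E]. Padding back
    to the original size recovers each block, which gives injectivity. *)
Lemma local_iso_iso : multimx_iso (local_sub E) local_iso.
Proof.
split.
- move=> c x y; apply: usa_val_inj => t.
  rewrite usa_addE usa_scaleE !local_isoE -glue_lin; congr (glue V E _ t).
  apply/funext => {}t; have [/summand_eq_local[i ->]|tE] := boolP (t \in summands E).
    by rewrite !spread_summand pad_lin.
  by rewrite !spread_notin// scaler0 addr0.
- move=> x y; apply: usa_val_inj => t.
  rewrite usa_mulE !local_isoE -(glueM V_unitary); congr (glue V E _ t).
  apply/funext => {}t; have [/summand_eq_local[i ->]|tE] := boolP (t \in summands E).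
    by rewrite !spread_summand padM// summand_size_le2.
  by rewrite !spread_notin// mul0mx.
- move=> x; apply: usa_val_inj => t.
  rewrite usa_starE !local_isoE -glue_star; congr (glue V E _ t).
  apply/funext => {}t; have [/summand_eq_local[i ->]|tE] := boolP (t \in summands E).
    by rewrite !spread_summand pad_star.
  by rewrite !spread_notin// trmx0 map_mx0.
- move=> x y xy; apply: functional_extensionality_dep => i.
  have padK w : pad (local_size i) (pad 2 w) = w :> 'M[R[i]]_(local_size i).
    by rewrite (pad_pad _ _ (summand_size_le2 _)) pad_id.
  by rewrite -[LHS]padK -local_iso_summand xy local_iso_summand padK.
apply/seteqP; split=> [_ [x _ <-]|a aE]; first exact: local_iso_local.
by exists (local_coords a) => //; exact: local_coordsK.
Qed.

Lemma spread_single i (a : 'M[R[i]]_(local_size i)) t :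
  spread (dfwith (T := fun i => 'M[R[i]]_(local_size i)) (fun=> 0) i a) t =
  if t == local_summand i then pad 2 a else 0.
Proof.
have [/summand_eq_local[j ->]|tE] := boolP (t \in summands E); last first.
  by rewrite spread_notin//; case: eqP => // tt; rewrite tt local_summand_in in tE.
rewrite spread_summand (inj_eq (@local_summand_inj E)).
have [->|ji] := eqVneq j i; first by rewrite dfwithin.
by rewrite dfwithout 1?eq_sym// pad0.
Qed.

End Spread.

(* The pair [(x, y)] outside [E * E] receives one copy of the point [x] and one
   copy of the point [y]; at most one of the two lies in [E]. *)
Definition local_mult E (u t : T) : bool :=
  if u \in summands E then u == t
  else if u is inr (x, y) then (inl x == t) || (inl y == t) else false.

(** The copy of the point x sits in the block through the identity, that of y through V. Both are
    unitary, so the multiplicity does not see the twist. *)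
Lemma boundary_multiplicity E t u : t \in summands E -> u \notin summands E ->
  has_multiplicity (fun a : 'M[R[i]]_(summand_size t) => pad (summand_size u)
    (twist V (fun w => if w == t then pad 2 a else 0) u)) (local_mult E u t).
Proof.
have unit1 n : (1%:M : 'M[R[i]]_n) \is unitarymx.
  by apply/unitarymxP; rewrite mul1mx trmx1 map_mx1.
have conjV0 : conjV V 0 = 0 by rewrite /conjV mulmx0 mul0mx.
move=> tE uE; rewrite /local_mult (negbTE uE); case: u uE => [x|[x y]] uE.
  by apply: (@has_multiplicity_le1 _ _ _ false 1%:M) => // a; rewrite pad0.
have [xt|xt] := eqVneq (inl x) t.
  (* If both coordinates were the point [t] of [E], the pair would lie in the square of [E]. *)
  have yt : inl y == t = false.
    apply/negP => /eqP yt; move: uE; rewrite mem_summands_inr.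
    have [<-] : inl x = inl y :> X + X * X by rewrite xt yt.
    by rewrite andbb -mem_summands_inl xt tE.
  apply: (@has_multiplicity_le1 _ _ _ true 1%:M) => [_||a];
    [exact: summand_size_le2|exact: unit1|].
  by rewrite /= xt eqxx yt conjV0 addr0 pad_id mul1mx trmx1 map_mx1 mulmx1.
apply: (@has_multiplicity_le1 _ _ _ (inl y == t) V) => [_||a];
  [exact: summand_size_le2|exact: V_unitary|].
by rewrite /= (negbTE xt) add0r pad_id; case: ifP.
Qed.

(** The inclusion reads off the coordinates over [F] of an element local over [E]. Summands of [E]
    are carried identically to themselves; the others are handled by [boundary_multiplicity]. *)
Lemma local_inclusion E F : {subset E <= F} ->
  exists phi : multimx R (@local_size E) -> multimx R (@local_size F),
    (forall x, local_iso (phi x) = local_iso x) /\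
    has_multiplicity_matrix phi
      (\matrix_(j, i) (local_mult E (local_summand j) (local_summand i) : nat)).
Proof.
move=> EF; exists (fun x => @local_coords F (local_iso x)); split=> [x|j i].
  apply: local_coordsK.
  exact: (local_subalgebraS V_unitary E F).2 EF _ (local_iso_local x).
rewrite mxE /local_coords /local_size.
set u := local_summand j; set t := local_summand i.
have tE : t \in summands E by exact: local_summand_in.
have unit1 n : (1%:M : 'M[R[i]]_n) \is unitarymx.
  by apply/unitarymxP; rewrite mul1mx trmx1 map_mx1.
have single a w := @spread_single E i a w.
have cut_single a w : cut E (spread (dfwith (T := fun i => 'M[R[i]]_(local_size i))
    (fun=> 0) i a)) w = if w == t then pad 2 a else 0.
  rewrite /cut single; case: ifPn => // wE.
  by case: eqP => // wt; rewrite wt tE in wE.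
have [uE|uE] := boolP (u \in summands E).
  apply: (@has_multiplicity_le1 _ _ _ (local_mult E u t) 1%:M) => [||a]; last 1 first.
  - rewrite local_isoE glue_in// single /local_mult uE; case: ifP => _; last by rewrite pad0.
    by rewrite pad_pad ?summand_size_le2// mul1mx trmx1 map_mx1 mulmx1.
  - by rewrite /local_mult uE => /eqP->.
  - exact: unit1.
have phiE a : local_iso (dfwith (T := fun i => 'M[R[i]]_(local_size i))
    (fun=> 0) i a) u = twist V (fun w => if w == t then pad 2 a else 0) u.
  rewrite local_isoE (glue_notin V _ uE); congr (twist V _ u); exact/funext.
have := boundary_multiplicity tE uE; congr has_multiplicity.
by apply/funext => a; rewrite phiE.
Qed.

End LocalIso.

(** * Bratteli diagrams *)

(** The images under [psi] of the matrix units, indexed by summand, row and column, span [S]. *)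
Lemma multimx_iso_finite_dimensional (R : realType) (A : cstarAlgType R) (S : set A)
    (k : nat) (n : 'I_k -> nat) (psi : multimx R n -> A) :
  multimx_iso S psi -> finite_dimensional S.
Proof.
move=> [psi_lin _ _ _ psiS].
pose J := {i : 'I_k & ('I_(n i) * 'I_(n i))%type}.
pose mk (c : J -> R[i]) : multimx R n :=
  fun i => \matrix_(p, q) c (Tagged (fun i => 'I_(n i) * 'I_(n i))%type (p, q)).
pose unit_mx j := psi (mk (fun l => (j == l)%:R)).
have psi0 : psi (mk (fun=> 0)) = 0.
  have := psi_lin (-1) (mk (fun=> 0)) (mk (fun=> 0)); rewrite scaleN1r addNr => <-.
  congr psi; apply: functional_extensionality_dep => i.
  by apply/matrixP => p q; rewrite !mxE mulr0 addr0.
(* Linearity of [psi] is given only in the form [c *: x + y], so sums are built up along a list. *)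
have psi_seq (c : J -> R[i]) r :
    psi (mk (fun l => \sum_(j <- r) c j * (j == l)%:R)) = \sum_(j <- r) c j *: unit_mx j.
  elim: r => [|j r IH].
    by rewrite big_nil -psi0; congr (psi (mk _)); apply/funext => l; rewrite big_nil.
  rewrite big_cons -IH -psi_lin; congr psi; apply: functional_extensionality_dep => i.
  by apply/matrixP => p q; rewrite !mxE big_cons.
have psi_sum (c : J -> R[i]) : psi (mk c) = \sum_j c j *: unit_mx j.
  rewrite -psi_seq; congr (psi (mk _)); apply/funext => l.
  rewrite (bigD1 l)//= eqxx mulr1 big1 ?addr0// => j /negbTE->.
  by rewrite mulr0.
exists #|{: J}|, (fun i => unit_mx (enum_val i)).
have reidx (c : J -> R[i]) : \sum_j c j *: unit_mx j =
    \sum_(i < #|{: J}|) c (enum_val i) *: unit_mx (enum_val i).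
  rewrite (reindex (fun i : 'I_#|{: J}| => enum_val i))//=.
  by exists enum_rank => i _; [exact: enum_valK|exact: enum_rankK].
rewrite -psiS; apply/seteqP; split=> [_ [x _ <-]|_ [c ->]].
  pose c (j : J) := x (tag j) (tagged j).1 (tagged j).2.
  exists (fun i => c (enum_val i)); rewrite -reidx -psi_sum; congr psi.
  by apply: functional_extensionality_dep => i; apply/matrixP => p q; rewrite mxE.
exists (mk (fun j => c (enum_rank j))) => //; rewrite psi_sum reidx.
by apply: eq_bigr => i _; rewrite enum_valK.
Qed.

Section SupportDiagram.
Variable X : choiceType.

Lemma local_size_gt0 (E : {fset X}) (i : 'I_(size (summands E))) : (0 < local_size i)%N.
Proof. by rewrite /local_size; case: (local_summand i). Qed.

(** Computed from the finite supports alone, without reference to V; this is why different twists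
    give isomorphic diagrams. *)
Definition support_diagram (I : Type) (supp : I -> {fset X}) : bratteli_diagram I :=
  BratteliDiagram (fun l => @local_size_gt0 (supp l)) (fun m l =>
    \matrix_(j, i) (local_mult (supp l) (local_summand j) (local_summand i) : nat)).

Lemma support_diagram_isomorphic (I J : Type) (leI : I -> I -> Prop)
    (leJ : J -> J -> Prop) (suppI : I -> {fset X}) (suppJ : J -> {fset X}) (f : I -> J) :
  bijective f -> (forall l, suppJ (f l) = suppI l) ->
  (forall l m, leI l m <-> leJ (f l) (f m)) ->
  bratteli_isomorphic leI leJ (support_diagram suppI) (support_diagram suppJ).
Proof.
move=> bij_f suppE f_mono.
have size_eq l : size (summands (suppI l)) = size (summands (suppJ (f l))).
  by rewrite suppE.
have summand_cast l (i : 'I_(size (summands (suppI l)))) :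
    local_summand (cast_ord (size_eq l) i) = local_summand i.
  by rewrite /local_summand !(tnth_nth (local_summand i)) /= suppE.
exists f, (fun l => cast_ord (size_eq l)); split.
- exact: bij_f.
- exact: f_mono.
- move=> l; exists (cast_ord (esym (size_eq l))); first exact: cast_ordK.
  exact: cast_ordKV.
- by move=> l i; rewrite /= /local_size summand_cast.
by move=> l m _ j i; rewrite /= !mxE !summand_cast suppE.
Qed.

End SupportDiagram.

(** * The directed family of local subalgebras and its diagram *)

Section LocalFamily.
Variables (R : realType) (X : choiceType) (V : 'M[R[i]]_2).
Hypothesis V_unitary : V \is unitarymx.
Local Notation A := (usa_elt (twisted_algebra X V_unitary)).
Local Notation local_sub := (@local_subalgebra R X V V_unitary).

Definition local_family : set (set A) := range local_sub.

Lemma local_family_af : af_family local_family.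
Proof.
split.
- move=> _ [E _ <-]; split; first exact: local_subalgebra_cstar.
  exact: multimx_iso_finite_dimensional (local_iso_iso V_unitary E).
- move=> _ _ [E _ <-] [F _ <-]; exists (local_sub (E `|` F)%fset).
  split; first by exists (E `|` F)%fset.
    by apply/local_subalgebraS => x xE; rewrite inE xE.
  by apply/local_subalgebraS => x xF; rewrite inE xF orbT.
move=> O [a Oa] openO.
have /nbhs_ballP[e /= e0 aeO] : nbhs a O by exact: open_nbhs_nbhs.
have [E [b bE abe]] := local_subalgebra_dense a e0.
exists b; split; first by apply: aeO; rewrite -ball_normE.
by exists (local_sub E) => //; exists E.
Qed.

(** The family is indexed by subalgebras, so the finite set is recovered by choice; it is unique by
    [local_subalgebra_inj]. *)
Definition family_support (S : local_family) : {fset X} := s2val (cid2 (set_valP S)).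

Lemma family_supportE (S : local_family) : local_sub (family_support S) = val S.
Proof. by rewrite /family_support; case: cid2. Qed.

Definition family_member (E : {fset X}) : local_family :=
  SigSub (mem_set (ex_intro2 _ _ E I erefl : local_family (local_sub E))).

Lemma family_memberK : cancel family_member family_support.
Proof.
by move=> E; apply: (@local_subalgebra_inj _ _ _ V_unitary); rewrite family_supportE.
Qed.

Lemma family_supportK : cancel family_support family_member.
Proof. by move=> S; apply/val_inj; rewrite /= family_supportE. Qed.

Lemma family_leE (S S' : local_family) :
  family_le S S' <-> {subset family_support S <= family_support S'}.
Proof. by rewrite /family_le -!family_supportE local_subalgebraS. Qed.

Lemma family_diagram_support : family_diagram (support_diagram family_support).
Proof.
exists (fun S => @local_iso R X V V_unitary (family_support S)); split=> [S|S S' [SS' _]].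
  by rewrite -family_supportE; exact: local_iso_iso.
have [phi [phiE phi_mult]] := local_inclusion V_unitary ((family_leE S S').1 SS').
by exists phi.
Qed.

End LocalFamily.

(** Members with the same finite support correspond. For both twists, inclusion of members is
    inclusion of supports. *)
Lemma twisted_diagrams_isomorphic (R : realType) (X : choiceType) (V W : 'M[R[i]]_2)
    (V_unitary : V \is unitarymx) (W_unitary : W \is unitarymx) :
  bratteli_isomorphic
    (@family_le R _ (@local_family R X V V_unitary))
    (@family_le R _ (@local_family R X W W_unitary))
    (support_diagram (@family_support R X V V_unitary))
    (support_diagram (@family_support R X W W_unitary)).
Proof.
pose f (S : @local_family R X V V_unitary) := family_member W_unitary (family_support S).
apply: (@support_diagram_isomorphic _ _ _ _ _ _ _ f).
- exists (fun S => family_member V_unitary (family_support S)) => S.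
    by rewrite family_memberK family_supportK.
  by rewrite /f family_memberK family_supportK.
- by move=> S; rewrite family_memberK.
by move=> S S'; rewrite !family_leE !family_memberK.
Qed.

(** * Non-isomorphism *)

Section Ideal.
Variables (R : realType) (X : choiceType) (V : 'M[R[i]]_2).
Hypothesis V_unitary : V \is unitarymx.
Local Notation T := (summand X).
Local Notation A := (usa_elt (twisted_algebra X V_unitary)).

Definition in_ideal (a : A) := forall x, a (inl x) = 0.

Lemma defect_ideal (b : T -> 'M[R[i]]_2) : (forall x, b (inl x) = 0) -> defect V b = b.
Proof.
move=> b0; apply/funext => -[x|[x y]]; first by rewrite defect_inl.
by rewrite /defect /= !b0 /conjV mulmx0 mul0mx addr0 subr0.
Qed.

Lemma ideal_vanishing (a : A) : in_ideal a -> vanishing a.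
Proof. by move=> a0; have := (usa_valP a).2; rewrite defect_ideal. Qed.

Lemma ideal_mem (b : T -> 'M[R[i]]_2) : (forall x, b (inl x) = 0) -> vanishing b ->
  usa_mem (twisted_algebra X V_unitary) b.
Proof.
move=> b0 vb; split=> [x|]; first by rewrite b0; exact: corner0.
by rewrite defect_ideal.
Qed.

Lemma commutator_ideal (a b : A) : in_ideal (cmul a b - cmul b a).
Proof.
move=> x; rewrite usa_subE !usa_mulE (corner_comm (n := b (inl x))) ?subrr//;
  exact: twisted_corner.
Qed.

Lemma ideal_mull (a b : A) : in_ideal a -> in_ideal (cmul a b).
Proof. by move=> a0 x; rewrite usa_mulE a0 mul0mx. Qed.

(* With [s^4] the sum of the moduli of the entries of [a], the commutator
   [s e12, s e21] is [s^2 (e11 - e22)], and [a] is its product with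
   [s^-2 (e11 - e22) a], which still vanishes at infinity. *)
Lemma ideal_commutator_factor (a : A) : in_ideal a ->
  exists u v b : A, a = cmul (cmul u v - cmul v u) b.
Proof.
move=> a0; have va := ideal_vanishing a0.
pose N t := \sum_p \sum_q `|a t p q|.
have N0 t : 0 <= N t by apply: sumr_ge0 => p _; apply: sumr_ge0.
have aN t p q : `|a t p q| <= N t.
  rewrite /N (bigD1 p)//= (bigD1 q)//= -addrA lerDl addr_ge0//.
    by rewrite sumr_ge0.
  by apply: sumr_ge0 => ? _; apply: sumr_ge0.
have N_inl x : N (inl x) = 0.
  by apply: big1 => p _; apply: big1 => q _; rewrite a0 mxE normr0.
have vN (e : R[i]) : 0 < e -> exists E : {fset X},
    forall t, t \notin summands E -> N t <= e.
  move=> e0; have [|E aE] := va (e / 4); first by rewrite divr_gt0.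
  exists E => t tE; apply: (@le_trans _ _ (\sum_(p < 2) \sum_(q < 2) e / 4)).
    by apply: ler_sum => p _; apply: ler_sum => q _; exact: aE.
  by rewrite !sumr_const !card_ord -mulrnA -[_ *+ _]mulr_natr divfK ?pnatr_eq0.
pose w t := sqrtC (N t); pose s t := sqrtC (w t).
have w0 t : 0 <= w t by rewrite sqrtC_ge0.
have s0 t : 0 <= s t by rewrite sqrtC_ge0.
have s_inl x : s (inl x) = 0 by rewrite /s /w N_inl !sqrtC0.
have vw (e : R[i]) : 0 < e -> exists E : {fset X},
    forall t, t \notin summands E -> w t <= e.
  move=> e0; have [|E NE] := vN (e ^+ 2); first exact: exprn_gt0.
  by exists E => t tE; apply: sqrtC_le => //; [exact: ltW|exact: NE].
have vs (m : 'M[R[i]]_2) : (forall p q, `|m p q| <= 1) -> vanishing (fun t => s t *: m).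
  move=> m1 e e0; have [|E wE] := vw (e ^+ 2); first exact: exprn_gt0.
  exists E => t tE p q; rewrite mxE normrM (ger0_norm (s0 t)).
  apply: (@le_trans _ _ (s t)); first by rewrite ler_piMr.
  by apply: sqrtC_le => //; [exact: ltW|exact: wE].
have delta_le1 (p q i j : 'I_2) : `|(delta_mx p q : 'M[R[i]]_2) i j| <= 1.
  by rewrite mxE; case: (_ && _); rewrite ?normr1 ?normr0.
pose D : 'M[R[i]]_2 := delta_mx 0 0 - delta_mx 1 1.
have DD : D *m D = 1%:M.
  apply/matrixP => p q; rewrite !mxE !big_ord_recl big_ord0 !mxE addr0.
  by case: p => [[|[|//]] ?]; case: q => [[|[|//]] ?];
    rewrite /= ?subr0 ?sub0r ?mulr0 ?mul0r ?mulrNN ?mulr1 ?addr0 ?add0r.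
have Da t p q : `|(D *m a t) p q| <= N t.
  apply: le_trans (aN t p q); rewrite mxE.
  rewrite !big_ord_recl big_ord0 !mxE addr0.
  case: (unliftP ord0 p) => [k|] ->; rewrite ?(ord1 k) /=.
    by rewrite subr0 mul0r add0r sub0r mulN1r normrN.
  by rewrite !subr0 mul1r mul0r addr0.
have mem_s (m : 'M[R[i]]_2) : (forall p q, `|m p q| <= 1) ->
    usa_mem (twisted_algebra X V_unitary) (fun t => s t *: m).
  by move=> m1; apply: ideal_mem => [x|]; [rewrite s_inl scale0r|exact: vs].
have mem_b : usa_mem (twisted_algebra X V_unitary) (fun t => (w t)^-1 *: (D *m a t)).
  apply: ideal_mem => [x|e e0]; first by rewrite a0 mulmx0 scaler0.
  have [E wE] := vw e e0; exists E => t tE p q; apply: le_trans (wE t tE).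
  rewrite mxE normrM normfV (ger0_norm (w0 t)).
  (* Entries of [D *m a t] are at most [N t], the square of [w t], so dividing by [w t] leaves at
     most [w t]. Where [w t] is 0 its inverse is 0 by convention. *)
  have [->|wt0] := eqVneq (w t) 0; first by rewrite invr0 mul0r.
  rewrite mulrC ler_pdivrMr ?lt_def ?wt0 ?w0// -expr2 sqrtCK.
  exact: Da.
exists (UsaElt (mem_s _ (delta_le1 0 1))), (UsaElt (mem_s _ (delta_le1 1 0))), (UsaElt mem_b).
apply: usa_val_inj => t; rewrite usa_mulE usa_subE !usa_mulE /=.
rewrite -!scalemxAl -!scalemxAr !scalerA -expr2 sqrtCK -scalerBr.
rewrite !mul_delta_mx -/D -scalemxAl mulmxA DD mul1mx scalerA.
have [wt0|wt0] := eqVneq (w t) 0; last by rewrite mulVf// scale1r.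
(* Where the weight is 0, all entries of [a t] are 0, and both sides agree. *)
have Nt0 : N t = 0 by rewrite -[N t]sqrtCK -/(w t) wt0 expr0n.
rewrite wt0 mulr0 scale0r; apply/matrixP => p q; rewrite [RHS]mxE; apply/eqP.
by rewrite -normr_le0 -Nt0.
Qed.

End Ideal.

(** Choose x outside the naturals and outside the countable union of the sets [f n]; then some
    natural number avoids the finite set [f x]. *)
Lemma free_pair (R : realType) (f : R -> {fset R}) :
  exists x y, [/\ x != y, y \notin f x & x \notin f y].
Proof.
pose U : set R := (\bigcup_n [set` f n%:R]) `|` range (fun n : nat => n%:R : R).
have cU : countable U.
  rewrite /U -bigcup2E; apply: bigcup_countable => // -[|[|n]] _ /=.
  - by apply: bigcup_countable => // n _; exact/finite_set_countable/finite_fset.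
  - exact: card_image_le.
  - exact: countable0.
have [x xU] : exists x, ~ U x.
  apply: contrapT => /forallNP U_all.
  (* The line is not countable: its Lebesgue measure is not 0. *)
  have := countable_lebesgue_measure0 cU; rewrite (_ : U = setT); last first.
    by apply/seteqP; split=> // x _; apply: contrapT; exact: U_all.
  have := @lebesgue_measure_itv R `]-oo, +oo[.
  by rewrite set_itvNyy => -> /=.
have [n nx] : exists n : nat, n%:R \notin f x.
  apply: contrapT => /forallNP all_in.
  have := @uniq_leq_size _ [seq n%:R | n <- iota 0 (size (f x)).+1] (f x) _ _.
  rewrite size_map size_iota ltnn => h; suff: false by [].
  apply: h; first by rewrite map_inj_uniq ?iota_uniq//; exact: (@mulrIn R 1 (oner_neq0 _)).
  by move=> _ /mapP[n _ ->]; have /negP := all_in n; rewrite negbK.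
exists x, n%:R; split=> //; apply/negP.
  by move=> /eqP xn; apply: xU; right; exists n.
by move=> xn; apply: xU; left; exists n.
Qed.

Lemma star_homB (R : realType) (C D : cstarAlgType R) (f : C -> D) x y : star_hom f ->
  f (x - y) = f x - f y.
Proof. by case=> f_lin _ _; rewrite addrC -scaleN1r f_lin scaleN1r addrC. Qed.

(** * The obstruction to an isomorphism *)

Section NonIsomorphism.
Variables (R : realType) (W : 'M[R[i]]_2).
Hypothesis W_unitary : W \is unitarymx.
Local Notation I1 := (1%:M : 'M[R[i]]_2).

Lemma unitarymx1 : I1 \is unitarymx.
Proof. by apply/unitarymxP; rewrite mul1mx trmx1 map_mx1. Qed.

Lemma conjV1 (m : 'M[R[i]]_2) : conjV I1 m = m.
Proof. by rewrite /conjV mul1mx trmx1 map_mx1 mulmx1. Qed.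

Local Notation A := (usa_elt (twisted_algebra R unitarymx1)).
Local Notation B := (usa_elt (twisted_algebra R W_unitary)).
Local Notation proj := (@point_projection R R W W_unitary).

(* For the trivial twist, the quotient by the ideal lifts to commuting
   elements. *)
Definition commuting_lift_val (a : A) t := points a t + twist I1 a t.

(** The defect of the lift is [points a], which vanishes at infinity. *)
Lemma commuting_lift_mem a : usa_mem (twisted_algebra R unitarymx1) (commuting_lift_val a).
Proof.
split=> [x|]; first by rewrite /commuting_lift_val /= addr0; exact: twisted_corner.
have := points_vanishing (usa_valP a).2; congr vanishing; apply/funext => -[x|[x y]].
  by rewrite defect_inl /commuting_lift_val /= addr0.
by rewrite /defect /commuting_lift_val /= add0r !addr0 !conjV1 subrr.
Qed.
Definition commuting_lift a : A := UsaElt (commuting_lift_mem a).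

(** With the trivial twist the value at (x, y) is the sum of the values at x and y, both multiples
    of e11. *)
Lemma commuting_lift_corner a t : corner (commuting_lift a t).
Proof.
case: t => [x|[x y]]; first exact: twisted_corner.
rewrite /= /commuting_lift_val /= add0r conjV1 -[a (inl x)]scale1r.
by apply: corner_lin; exact: twisted_corner.
Qed.

Lemma commuting_liftC a b :
  cmul (commuting_lift a) (commuting_lift b) = cmul (commuting_lift b) (commuting_lift a).
Proof.
by apply: usa_val_inj => t; rewrite !usa_mulE; apply: corner_comm;
  exact: commuting_lift_corner.
Qed.

Lemma commuting_lift_ideal a : in_ideal (a - commuting_lift a).
Proof. by move=> x; rewrite usa_subE /= /commuting_lift_val /= addr0 subrr. Qed.

(** An element of the ideal is a commutator times another element. The homomorphism preserves this
    form, and commutators lie in the ideal because the values at points commute. *)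
Lemma star_hom_ideal (f : A -> B) a : star_hom f -> in_ideal a -> in_ideal (f a).
Proof.
move=> hf /ideal_commutator_factor[u [v [b ->]]]; have [_ fM _] := hf.
rewrite fM star_homB// !fM; apply: ideal_mull; exact: commutator_ideal.
Qed.

Lemma point_projection_pair x y : x != y ->
  (proj x (inr (x, y)) = delta_mx 0 0) /\
  (proj y (inr (x, y)) = conjV W (delta_mx 0 0)).
Proof.
move=> xy; have conjV0 : conjV W 0 = 0 by rewrite /conjV mulmx0 mul0mx.
have p_local z : local_subalgebra (V_unitary := W_unitary) [fset z]%fset
    (proj z) by exact: glued_local.
have notin z : inr (x, y) \notin summands [fset z]%fset.
  rewrite mem_summands_inr !inE; apply/negP => /andP[/eqP xz /eqP yz].
  by rewrite xz yz eqxx in xy.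
rewrite !(local_twist (p_local _) (notin _)) /twist !point_projection_inl !eqxx.
by rewrite (negbTE xy) eq_sym (negbTE xy) conjV0 addr0 add0r.
Qed.

(** With m = p - r and n = p' - r', the commutator [p, p'] equals [p, n] + [m, p'] - [m, n]. Each
    term has entries at most 16 e; the assumption e <= 4 makes the last one linear in e. *)
Lemma commuting_near_entry (p p' r r' : 'M[R[i]]_2) (e : R[i]) : 0 <= e -> e <= 4 ->
  (forall i j, `|p i j| <= 4) -> (forall i j, `|p' i j| <= 4) ->
  (forall i j, `|(p - r) i j| <= e) -> (forall i j, `|(p' - r') i j| <= e) ->
  r *m r' = r' *m r -> forall i j, `|(p *m p' - p' *m p) i j| <= e * 48.
Proof.
move=> e0 e4 p4 p'4 k l rr i j; set m := p - r in k; set n := p' - r' in l.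
have comm : (p - m) *m (p' - n) = (p' - n) *m (p - m) by rewrite !subKr.
have -> : p *m p' - p' *m p = (p *m n - n *m p) + (m *m p' - p' *m m) + (n *m m - m *m n).
  clear k l; clearbody m n; move: comm; rewrite !mulmxBl !mulmxBr => comm.
  (* With the noncommuting products taken as independent matrices, the identity is linear and can be
     checked on entries. *)
  have swap (a b c d a' b' c' d' : R[i]) : a - b - (c - d) = a' - b' - (c' - d') ->
      a - a' = b - c' + (c - b') + (d' - d).
    move=> h; have -> : a = a - b - (c - d) + b + (c - d) by ring.
    by rewrite h; ring.
  move: (p *m p') (p *m n) (m *m p') (m *m n) (p' *m p) (p' *m m) (n *m p) (n *m m) comm.
  move=> a b c d a' b' c' d' h; apply/matrixP => u v.
  by move/matrixP/(_ u v): h; rewrite !mxE; exact: swap.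
have bound (u v : 'M[R[i]]_2) : (forall i j, `|u i j| <= 4) -> (forall i j, `|v i j| <= e) ->
    `|(u *m v - v *m u) i j| <= e * 16.
  move=> u4 ve; have -> : (u *m v - v *m u) i j = (u *m v) i j - (v *m u) i j by rewrite !mxE.
  apply: le_trans (ler_normB _ _) _.
  have -> : e * 16 = 4 * e * 2 + e * 4 * 2 by ring.
  by apply: lerD; apply: entry_mul_le.
have -> : e * 48 = e * 16 + e * 16 + e * 16 by ring.
have add (u v : 'M[R[i]]_2) (c d : R[i]) : `|u i j| <= c -> `|v i j| <= d ->
    `|(u + v) i j| <= c + d.
  by move=> uc vd; rewrite mxE; apply: le_trans (ler_normD _ _) _; exact: lerD.
apply: (add); last by apply: bound => // u v; exact: le_trans (l u v) e4.
apply: (add); first exact: bound.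
by rewrite -opprB mxE normrN; exact: bound.
Qed.

Lemma twisted_not_isomorphic : conjV W (delta_mx 0 0) 0 1 != 0 ->
  ~ cstar_isomorphic (A : cstarAlgType R) (B : cstarAlgType R).
Proof.
move=> w0 [f hf [g fK gK]].
pose a x := g (proj x).
pose r x := f (commuting_lift (a x)).
have k_ideal x : in_ideal (proj x - r x).
  rewrite -[proj _]gK -star_homB//.
  by apply: star_hom_ideal => //; exact: commuting_lift_ideal.
have r_comm x y : cmul (r x) (r y) = cmul (r y) (r x).
  by have [_ fM _] := hf; rewrite /r -!fM commuting_liftC.
set w := conjV W (delta_mx 0 0) 0 1 in w0.
have d4 i j : `|(delta_mx 0 0 : 'M[R[i]]_2) i j| <= 1.
  by rewrite mxE; case: (_ && _); rewrite ?normr1 ?normr0.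
have w4 i j : `|conjV W (delta_mx 0 0) i j| <= 4.
  by rewrite -[leRHS]mul1r; apply: conjV_entry_le.
(* With this error the commutator bound is 48 / 96 = 1/2 of |w|, which contradicts the value w of
   one of its entries. *)
have e0 : 0 < `|w| / 96 by rewrite divr_gt0 ?normr_gt0.
have /(_ _)/cid small x := ideal_vanishing (k_ideal x) e0.
have [x [y [xy yx' xy']]] := free_pair (fun x => sval (small x)).
have [px py] := point_projection_pair xy.
have notin z : (x \notin sval (small z)) || (y \notin sval (small z)) ->
    inr (x, y) \notin summands (sval (small z)).
  by rewrite mem_summands_inr negb_and.
have kx := svalP (small x) _ (notin x _).
have ky := svalP (small y) _ (notin y _).
have e4 : `|w| / 96 <= 4.
  rewrite ler_pdivrMr//; apply: le_trans (w4 0 1) _.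
  by rewrite ler_peMr// ler1n.
have := @commuting_near_entry (delta_mx 0 0) (conjV W (delta_mx 0 0))
  (r x (inr (x, y))) (r y (inr (x, y))) (`|w| / 96) (ltW e0) e4 _ w4 _ _ _ 0 1.
(* The (0, 1) entry of [e11, F] is that of F, so w measures the failure to commute. *)
have -> : (delta_mx 0 0 *m conjV W (delta_mx 0 0) - conjV W (delta_mx 0 0) *m delta_mx 0 0) 0 1
    = w :> R[i].
  rewrite /w; move: (conjV W _) => F; rewrite !mxE !big_ord_recl !big_ord0 !mxE /=.
  by rewrite mul1r !mul0r !mulr0 !addr0 subr0.
move=> h; suff : `|w| <= `|w| / 96 * 48.
  rewrite -mulrA ler_pMr ?normr_gt0// (_ : 96 = 48 * 2); last by rewrite -natrM.
  by rewrite invfM mulrAC mulVf ?pnatr_eq0// mul1r invf_ge1// lern1.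
apply: h => [i j|i j|i j|].
- by apply: le_trans (d4 i j) _; rewrite ler1n.
- by rewrite -px -usa_subE; apply: kx; rewrite yx' orbT.
- by rewrite -py -usa_subE; apply: ky; rewrite xy'.
- by rewrite -!usa_mulE r_comm.
Qed.

End NonIsomorphism.

(** * A concrete nontrivial twist *)

Section Rotation.
Variable R : realType.

(** The 3-4-5 triangle gives a rotation with rational entries. *)
Definition rotation : 'M[R[i]]_2 := \matrix_(i, j)
  if i == j then 3 / 5 else if i == 0 then 4 / 5 else - (4 / 5).

Lemma conj_nat_frac (m n : nat) : Num.conj (m%:R / n%:R : R[i]) = m%:R / n%:R.
Proof. by apply: geC0_conj; rewrite divr_ge0. Qed.

Lemma rotation_unitary : rotation \is unitarymx.
Proof.
apply/unitarymxP/matrixP => i j; rewrite !mxE !big_ord_recl big_ord0 !mxE.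
case: (unliftP ord0 i) => [i'|] ->; rewrite ?(ord1 i'); case: (unliftP ord0 j) => [j'|] ->;
  rewrite ?(ord1 j') /= ?rmorphN /= ?conj_nat_frac; by field.
Qed.

(** The entry is (3/5)(-4/5) = -12/25. *)
Lemma rotation_projection : conjV rotation (delta_mx 0 0) 0 1 != 0.
Proof.
rewrite /conjV !mxE !big_ord_recl !big_ord0 !mxE !big_ord_recl !big_ord0 !mxE /=.
rewrite !mulr0 !mulr1 !addr0 mul0r addr0 rmorphN /= conj_nat_frac mulrN oppr_eq0.
by rewrite !mulf_neq0 ?invr_neq0 ?pnatr_eq0.
Qed.

End Rotation.

Theorem theorem1p6 (R : realType) :
  exists A B : cstarAlgType R,
    [/\ af_algebra A, af_algebra B, ~ cstar_isomorphic A B &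
      exists (FA : set (set A)) (FB : set (set B)),
        [/\ af_family FA, af_family FB &
          exists (DA : bratteli_diagram FA) (DB : bratteli_diagram FB),
            [/\ family_diagram DA, family_diagram DB &
              bratteli_isomorphic (@family_le R A FA) (@family_le R B FB)
                DA DB]]].
Proof.
pose u1 := unitarymx1 R; have u2 := rotation_unitary R.
exists (usa_elt (twisted_algebra R u1)), (usa_elt (twisted_algebra R u2)).
split.
- by exists (@local_family R R _ u1); exact: local_family_af.
- by exists (@local_family R R _ u2); exact: local_family_af.
- exact: twisted_not_isomorphic (rotation_projection R).
exists (@local_family R R _ u1), (@local_family R R _ u2); split; [exact: local_family_af..|].
exists (support_diagram (@family_support R R _ u1)).
exists (support_diagram (@family_support R R _ u2)).
by split; [exact: family_diagram_support..|exact: twisted_diagrams_isomorphic].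
Qed.
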